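(* Let $U\subseteq\mathbf{R}^d$ be open, $\tau>0$ and $\sigma>1$. Let $P(\partial)=\sum_{|\alpha|=0}^{\infty}a_\alpha\partial^\alpha$ be a constant coefficient differential operator of infinite order such that for some $L>0$ and some $A>0$ (resp. for every $L>0$ there exists $A>0$ such that) $$|a_\alpha|\le A\,\frac{L^{|\alpha|^\sigma}}{|\alpha|^{\tau 2^{\sigma-1}|\alpha|^\sigma}},\qquad \alpha\in\mathbf{N}^d.$$ Then $\mathcal{E}_{\infty,\sigma}(U)$ is closed under the action of $P(\partial)$. In particular, $$P(\partial):\ \mathcal{E}_{\tau,\sigma}(U)\longrightarrow\mathcal{E}_{\tau2^{\sigma-1},\sigma}(U)$$ is a continuous linear mapping, where $\mathcal{E}_{\tau,\sigma}(U)$ denotes $\mathcal{E}_{(\tau,\sigma)}(U)$ (resp. $\mathcal{E}_{\{\tau,\sigma\}}(U)$), and $\mathcal{E}_{\tau2^{\sigma-1},\sigma}(U)$ denotes $\mathcal{E}_{(\tau2^{\sigma-1},\sigma)}(U)$ (resp. $\mathcal{E}_{\{\tau2^{\sigma-1},\sigma\}}(U)$).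
   Context: $\mathbf{N}$ denotes the nonnegative integers. For a compact set $K\subset U$ (with smooth boundary), $\tau>0$, $\sigma>1$ and $h>0$, $\mathcal{E}_{\tau,\sigma,h}(K)$ is the Banach space of smooth functions $\phi$ on $K$ with finite norm $$\|\phi\|_{\mathcal{E}_{\tau,\sigma,h}(K)}=\sup_{\alpha\in\mathbf{N}^d}\sup_{x\in K}\frac{|\partial^\alpha\phi(x)|}{h^{|\alpha|^\sigma}|\alpha|^{\tau|\alpha|^\sigma}}.$$ Powers $|\alpha|^{c|\alpha|^{\sigma}}$, $c>0$, are read as $1$ for $\alpha=0$. As topological spaces, $\mathcal{E}_{\{\tau,\sigma\}}(U)=\varprojlim_{K\subset\subset U}\varinjlim_{h\to\infty}\mathcal{E}_{\tau,\sigma,h}(K)$ (Roumieu class: for every compact $K\subset U$ the norm is finite for some $h>0$), $\mathcal{E}_{(\tau,\sigma)}(U)=\varprojlim_{K\subset\subset U}\varprojlim_{h\to0}\mathcal{E}_{\tau,\sigma,h}(K)$ (Beurling class: for every compact $K\subset U$ the norm is finite for every $h>0$), and $\mathcal{E}_{\infty,\sigma}(U)=\varinjlim_{\tau\to\infty}\mathcal{E}_{\tau,\sigma}(U)$, i.e. the union over all $\tau>0$ of the classes $\mathcal{E}_{\tau,\sigma}(U)$ (the Roumieu and Beurling versions give the same space).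
   Formalization: With the bound at one τ, P(∂)φ may diverge for φ in E_{∞,σ}(U), so closure is false as stated; proved instead: P(∂) maps E_{τ',σ}(U) into E_{∞,σ}(U) for 0<τ'<τ2^{σ-1}, and E_{∞,σ}(U) is closed if the bound holds for every τ'>0. *)

(* Defs.v *)
From HB Require Import structures.
From mathcomp Require Import all_boot all_order all_algebra.
From mathcomp Require Import complex.
From mathcomp Require Import all_classical all_reals all_analysis.

Set Implicit Arguments.
Unset Strict Implicit.
Unset Printing Implicit Defensive.

Import Order.TTheory GRing.Theory Num.Theory numFieldNormedType.Exports.
Local Open Scope classical_set_scope.
Local Open Scope ring_scope.

Notation mindex d := {ffun 'I_d -> nat}.

Definition mdeg (d : nat) (alpha : mindex d) : nat := (\sum_i alpha i)%N.

(* [:: 0; ..; 0; 1; ..; 1; ..], each i repeated (alpha i) times *)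
Definition mseq (d : nat) (alpha : mindex d) : seq 'I_d :=
  flatten [seq nseq (alpha i) i | i <- enum 'I_d].

Definition cmod (R : realType) (z : R[i]) : R := complex.Re `|z|.

Section smooth_functions.
Context (R : realType) (d : nat).
Implicit Types (A K : set 'rV[R]_d) (f : 'rV[R]_d -> R[i]).

Fixpoint iter_partial (s : seq 'I_d) (g : 'rV[R]_d -> R) : 'rV[R]_d -> R :=
  if s is i :: s' then fun x => 'D_(delta_mx 0 i) (iter_partial s' g) x else g.

(* The iterated partial derivatives, in any order, exist and are continuous
   near each point of A; for an open set A this is C^infinity on A. *)
Definition smooth_real A (g : 'rV[R]_d -> R) : Prop :=
  forall (s : seq 'I_d) x, A x -> \forall y \near x,
    {for y, continuous (iter_partial s g)} /\
    forall i, derivable (iter_partial s g) y (delta_mx 0 i).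

(* Functions on R^d are complex valued and are differentiated componentwise. *)
Definition smooth A f : Prop :=
  smooth_real A (@complex.Re R \o f) /\ smooth_real A (@complex.Im R \o f).

Definition mpartial (alpha : mindex d) f : 'rV[R]_d -> R[i] := fun x =>
  (iter_partial (mseq alpha) (@complex.Re R \o f) x
    +i* iter_partial (mseq alpha) (@complex.Im R \o f) x)%C.

(* K is, near each boundary point, the sublevel set {rho <= 0} of a smooth
   function rho with non-zero differential there. *)
Definition smooth_boundary K : Prop :=
  forall x, K x -> ~ K^° x ->
  exists (W : set 'rV[R]_d) (rho : 'rV[R]_d -> R),
    [/\ open W, W x, smooth_real W rho,
        exists i, 'D_(delta_mx 0 i) rho x != 0 &
        forall y, W y -> (K y <-> rho y <= 0)].

(* Smooth functions on a compact set K with smooth boundary: smooth in the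
   interior, with all derivatives extending continuously to K.  Only the
   values in the interior matter. *)
Definition smooth_real_upto K (g : 'rV[R]_d -> R) : Prop :=
  smooth_real K^° g /\
  forall s : seq 'I_d, exists2 e : 'rV[R]_d -> R, {within K, continuous e} &
    forall x, K^° x -> e x = iter_partial s g x.

Definition smooth_upto K f : Prop :=
  smooth_real_upto K (@complex.Re R \o f) /\
  smooth_real_upto K (@complex.Im R \o f).

End smooth_functions.

Section ultradifferentiable_classes.
Context (R : realType) (d : nat).
Implicit Types (A K U : set 'rV[R]_d) (f : 'rV[R]_d -> R[i]).
Implicit Types (tau sigma h : R).

(* 0 `^ c = 1 if c = 0 and 0 `^ c = 0 otherwise, so that for alpha = 0 and
   sigma > 1 both factors are 1. *)
Definition eweight tau sigma h (n : nat) : R :=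
  h `^ (n%:R `^ sigma) * n%:R `^ (tau * n%:R `^ sigma).

(* For K compact with smooth boundary and f smooth on K, the supremum over K
   of the (extended) derivatives is enorm tau sigma h K^° f. *)
Definition enorm tau sigma h A f : \bar R :=
  ereal_sup [set r | exists (alpha : mindex d) (x : 'rV[R]_d),
    A x /\ r = (cmod (mpartial alpha f x)
                / eweight tau sigma h (mdeg alpha))%:E].

Inductive uclass := Beurling | Roumieu.

Definition every_or_some (c : uclass) (P : R -> Prop) : Prop :=
  match c with
  | Beurling => forall h, 0 < h -> P h
  | Roumieu => exists2 h, 0 < h & P h
  end.

(* E_(tau,sigma)(U) and E_{tau,sigma}(U).  A function on U is represented by
   its extension by 0 to R^d. *)
Definition eclass (c : uclass) tau sigma U : set ('rV[R]_d -> R[i]) :=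
  [set f | [/\ smooth U f,
               forall x, ~ U x -> f x = 0 &
               forall K, compact K -> K `<=` U ->
                 every_or_some c (fun h => (enorm tau sigma h K f < +oo)%E)]].

Definition eclass_pred (c : uclass) tau sigma U : {pred 'rV[R]_d -> R[i]} :=
  fun f => f \in eclass c tau sigma U.

Definition eclass_infty (c : uclass) sigma U : set ('rV[R]_d -> R[i]) :=
  [set f | exists2 tau, 0 < tau & eclass c tau sigma U f].

Definition abs_convex (V : set ('rV[R]_d -> R[i])) : Prop :=
  forall f g (l m : R[i]), V f -> V g -> `|l| + `|m| <= 1 ->
    V (l *: f + m *: g).

(* The Banach space E_{tau,sigma,h}(K), with norm enorm tau sigma h K^°. *)
Definition estep tau sigma h K : set ('rV[R]_d -> R[i]) :=
  [set f | smooth_upto K f /\ (enorm tau sigma h K^° f < +oo)%E].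

(* Neighbourhoods of 0 in the projective limit (h -> 0) of the spaces
   E_{tau,sigma,h}(K), resp. in their locally convex inductive limit
   (h -> oo). *)
Definition nbhs0_local (c : uclass) tau sigma K :
    set_system ('rV[R]_d -> R[i]) :=
  match c with
  | Beurling => [set V | exists h eps : R, [/\ 0 < h, 0 < eps &
      forall f, (forall h', 0 < h' -> estep tau sigma h' K f) ->
        (enorm tau sigma h K^° f < eps%:E)%E -> V f]]
  | Roumieu => [set V | exists W, [/\ W `<=` V, abs_convex W &
      forall h, 0 < h -> exists2 eps : R, 0 < eps &
        forall f, estep tau sigma h K f ->
          (enorm tau sigma h K^° f < eps%:E)%E -> W f]]
  end.

End ultradifferentiable_classes.

Section closure_properties.
Context (R : realType) (d : nat).
Implicit Types (A K U : set 'rV[R]_d) (f g : 'rV[R]_d -> R[i]).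

Lemma iter_partial_lin A (u v : 'rV[R]_d -> R) (b c : R) :
  smooth_real A u -> smooth_real A v -> forall s x, A x ->
  \forall y \near x, iter_partial s (b \*: u + c \*: v) y =
    b * iter_partial s u y + c * iter_partial s v y.
Proof.
move=> su sv; elim=> [|i s IH] x Ax /=; first by near=> y.
have IHj := near_join (IH x Ax).
near=> y.
have E : \forall z \near y, iter_partial s (b \*: u + c \*: v) z =
    (b \*: iter_partial s u + c \*: iter_partial s v) z.
  by near: y; exact: IHj.
have [_ /(_ i) du] : {for y, continuous (iter_partial s u)} /\
    forall i, derivable (iter_partial s u) y (delta_mx 0 i).
  by near: y; exact: su.
have [_ /(_ i) dv] : {for y, continuous (iter_partial s v)} /\
    forall i, derivable (iter_partial s v) y (delta_mx 0 i).
  by near: y; exact: sv.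
rewrite (near_eq_derive _ E) deriveD; [|exact: derivableZ..].
by rewrite !deriveZ.
Unshelve. all: by end_near. Qed.

Lemma smooth_real_lin A (u v : 'rV[R]_d -> R) (b c : R) :
  smooth_real A u -> smooth_real A v -> smooth_real A (b \*: u + c \*: v).
Proof.
move=> su sv s x Ax.
have linj := near_join (iter_partial_lin b c su sv s Ax).
near=> y.
have E : \forall z \near y, (b \*: iter_partial s u + c \*: iter_partial s v) z
    = iter_partial s (b \*: u + c \*: v) z.
  by near: y; apply: filterS linj => y; apply: filterS => z ->.
have [cu du] : {for y, continuous (iter_partial s u)} /\
    forall i, derivable (iter_partial s u) y (delta_mx 0 i).
  by near: y; exact: su.
have [cv dv] : {for y, continuous (iter_partial s v)} /\
    forall i, derivable (iter_partial s v) y (delta_mx 0 i).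
  by near: y; exact: sv.
split=> [|i].
  rewrite /prop_for /continuous_at -(nbhs_singleton E).
  apply: (cvg_trans (near_eq_cvg E)).
  by apply: cvgD; apply: cvgZr.
by apply: near_eq_derivable E _; apply: derivableD; exact: derivableZ.
Unshelve. all: by end_near. Qed.

Lemma Re_lin f g (l : R[i]) : @complex.Re R \o (l *: f + g) =
  1 \*: (complex.Re l \*: (@complex.Re R \o f)
    + (- complex.Im l) \*: (@complex.Im R \o f))
  + 1 \*: (@complex.Re R \o g).
Proof.
apply/funext => x /=; rewrite !fctE /=.
case: l (f x) (g x) => [l1 l2] [a b] [p q] /=.
by rewrite /GRing.scale /= !mul1r mulNr.
Qed.

Lemma Im_lin f g (l : R[i]) : @complex.Im R \o (l *: f + g) =
  1 \*: (complex.Im l \*: (@complex.Re R \o f)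
    + complex.Re l \*: (@complex.Im R \o f))
  + 1 \*: (@complex.Im R \o g).
Proof.
apply/funext => x /=; rewrite !fctE /=.
case: l (f x) (g x) => [l1 l2] [a b] [p q] /=.
by rewrite /GRing.scale /= !mul1r [in RHS]addrC [_ + l1 * b]addrC addrC.
Qed.

Lemma smooth_lin A f g (l : R[i]) :
  smooth A f -> smooth A g -> smooth A (l *: f + g).
Proof.
move=> [f1 f2] [g1 g2]; split.
  by rewrite Re_lin; exact: (smooth_real_lin _ _ (smooth_real_lin _ _ f1 f2)).
by rewrite Im_lin; exact: (smooth_real_lin _ _ (smooth_real_lin _ _ f1 f2)).
Qed.

Lemma mpartial_lin A f g (l : R[i]) (alpha : mindex d) x :
  smooth A f -> smooth A g -> A x ->
  mpartial alpha (l *: f + g) x = l * mpartial alpha f x + mpartial alpha g x.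
Proof.
move=> [f1 f2] [g1 g2] Ax; rewrite /mpartial Re_lin Im_lin.
have D u v b c (su : smooth_real A u) (sv : smooth_real A v) :=
  nbhs_singleton (iter_partial_lin b c su sv (mseq alpha) Ax).
rewrite (D _ _ _ _ (smooth_real_lin _ _ f1 f2) g1) (D _ _ _ _ f1 f2).
rewrite (D _ _ _ _ (smooth_real_lin _ _ f1 f2) g2) (D _ _ _ _ f1 f2).
case: l => l1 l2 /=.
apply/eqP; rewrite eq_complex /= !mul1r mulNr eqxx /=.
by rewrite [l2 * _ + _]addrC.
Qed.

Lemma cmod_lin (l z w : R[i]) : cmod (l * z + w) <= cmod l * cmod z + cmod w.
Proof.
have := ler_normD (l * z) w; rewrite normrM /cmod !normc_def => /=.
by rewrite /= lecE /= => /andP[_]; rewrite !mulr0 subr0.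
Qed.

Lemma cmod_ge0 (z : R[i]) : 0 <= cmod z.
Proof. by rewrite /cmod normc_def /= sqrtr_ge0. Qed.

Lemma eweight_ge0 (tau sigma h : R) n : 0 <= eweight tau sigma h n.
Proof. by rewrite mulr_ge0 ?powR_ge0. Qed.

Lemma enorm_finP (tau sigma h : R) A f : (enorm tau sigma h A f < +oo)%E <->
  exists M : R, forall (alpha : mindex d) x, A x ->
    cmod (mpartial alpha f x) / eweight tau sigma h (mdeg alpha) <= M.
Proof.
split=> [fin|[M HM]].
  case E : (enorm tau sigma h A f) fin => [M| |] // _.
    exists M => alpha x Ax; rewrite -lee_fin -E.
    by apply: ereal_sup_ubound; exists alpha, x.
  exists 0 => alpha x Ax.
  have : ((cmod (mpartial alpha f x)
           / eweight tau sigma h (mdeg alpha))%:E <= -oo)%E.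
    by rewrite -E; apply: ereal_sup_ubound; exists alpha, x.
  by [].
apply: (@le_lt_trans _ _ M%:E); last exact: ltry.
by apply: ge_ereal_sup => _ [alpha [x [Ax ->]]]; rewrite lee_fin HM.
Qed.

Lemma enorm_lin (tau sigma h : R) A f g (l : R[i]) :
  smooth A f -> smooth A g ->
  (enorm tau sigma h A f < +oo)%E -> (enorm tau sigma h A g < +oo)%E ->
  (enorm tau sigma h A (l *: f + g)%R < +oo)%E.
Proof.
move=> sf sg /enorm_finP[M HM] /enorm_finP[N HN]; apply/enorm_finP.
exists (cmod l * M + N) => alpha x Ax.
rewrite (mpartial_lin _ _ sf sg Ax).
apply: (@le_trans _ _ ((cmod l * cmod (mpartial alpha f x)
    + cmod (mpartial alpha g x)) / eweight tau sigma h (mdeg alpha))).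
  by rewrite ler_wpM2r ?invr_ge0 ?eweight_ge0 ?cmod_lin.
rewrite mulrDl -mulrA lerD ?HN // ler_wpM2l ?cmod_ge0 //.
exact: HM.
Qed.

Lemma enorm_homo (tau sigma h h' : R) A f : 0 < h -> h <= h' ->
  (enorm tau sigma h A f < +oo)%E -> (enorm tau sigma h' A f < +oo)%E.
Proof.
move=> h0 hh' /enorm_finP[M HM]; apply/enorm_finP; exists M => alpha x Ax.
apply: le_trans (HM alpha x Ax); rewrite ler_wpM2l ?cmod_ge0 //.
rewrite /eweight.
have := powR_ge0 (mdeg alpha)%:R (tau * (mdeg alpha)%:R `^ sigma).
move: (_ `^ (tau * _)) => p p_ge0.
have [->|p0] := eqVneq p 0; first by rewrite !mulr0.
have pp : 0 < p by rewrite lt_neqAle eq_sym p0.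
have h'0 : 0 < h' by exact: lt_le_trans hh'.
rewrite lef_pV2 ?posrE ?mulr_gt0 ?powR_gt0 // ler_wpM2r ?(ltW pp) //.
by apply: ge0_ler_powR => //; rewrite ?nnegrE ?powR_ge0 //; exact: ltW.
Qed.

Lemma smoothS A B f : A `<=` B -> smooth B f -> smooth A f.
Proof. by move=> AB [sr si]; split=> s x /AB; [exact: sr|exact: si]. Qed.

Lemma smooth_real0 A : smooth_real A (cst 0 : 'rV[R]_d -> R).
Proof.
have E s : iter_partial s (cst 0 : 'rV[R]_d -> R) = cst 0.
  by elim: s => //= i s ->; apply/funext => x; rewrite derive_cst.
move=> s x _; near=> y; rewrite E; split=> [|i]; first exact: cst_continuous.
exact: derivable_cst.
Unshelve. all: by end_near. Qed.

Lemma eclass_submod c (tau sigma : R) U :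
  GRing.submod_closed (eclass_pred c tau sigma U).
Proof.
split=> [|l f g]; rewrite ![_ \in eclass_pred _ _ _ _]unfold_in ?in_setE.
  have s0 : smooth U (0 : 'rV[R]_d -> R[i]) by split; exact: smooth_real0.
  have n0 h K : K `<=` U -> (enorm tau sigma h K (0 : 'rV[R]_d -> R[i])%R < +oo)%E.
    move=> KU; apply/enorm_finP; exists 0 => alpha x /KU Ux.
    have := mpartial_lin (-1) alpha s0 s0 Ux.
    rewrite scaler0 addr0 mulN1r addNr => ->.
    by rewrite /cmod normr0 mul0r.
  split=> // K _ KU; case: c => /= [h h0|]; first exact: n0.
  by exists 1 => //; exact: n0.
move=> [sf f0 Hf] [sg g0 Hg]; split; first exact: smooth_lin.
  move=> x Ux; have -> : (l *: f + g) x = l * f x + g x by [].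
  by rewrite f0 // g0 // mulr0 addr0.
move=> K cK KU; have sf' := smoothS KU sf; have sg' := smoothS KU sg.
move: (Hf K cK KU) (Hg K cK KU); case: c {Hf Hg} => /= [Hf Hg h h0|].
  by apply: enorm_lin => //; [exact: Hf|exact: Hg].
move=> [h h0 Hf] [h' h'0 Hg]; exists (Num.max h h').
  by rewrite lt_max h0.
apply: enorm_lin => //.
  by apply: enorm_homo Hf => //; rewrite le_max lexx.
by apply: enorm_homo Hg => //; rewrite le_max lexx orbT.
Qed.

End closure_properties.

HB.instance Definition _ (R : realType) (d : nat) (c : uclass) (tau sigma : R)
    (U : set 'rV[R]_d) :=
  GRing.isSubmodClosed.Build R[i] ('rV[R]_d -> R[i])
    (eclass_pred c tau sigma U) (eclass_submod c tau sigma U).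

(* The space E_(tau,sigma)(U), resp. E_{tau,sigma}(U). *)
Record espace (R : realType) (d : nat) (c : uclass) (tau sigma : R)
    (U : set 'rV[R]_d) := ESpace {
  efun :> 'rV[R]_d -> R[i];
  _ : efun \in eclass_pred c tau sigma U }.

Section espace_topology.
Context (R : realType) (d : nat) (c : uclass) (tau sigma : R).
Context (U : set 'rV[R]_d).
Local Notation E := (espace c tau sigma U).

HB.instance Definition _ := [isSub of E for @efun R d c tau sigma U].
HB.instance Definition _ := [Choice of E by <:].
HB.instance Definition _ := [SubChoice_isSubLmodule of E by <:].

(* Neighbourhoods of f in the projective limit over the compact sets K. *)
Definition nbhs_espace (f : E) : set_system E :=
  smallest (@Filter E) [set W | exists K V,
    [/\ compact K, K `<=` U, smooth_boundary K,
        nbhs0_local c tau sigma K V &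
        W = [set g : E | V ((g : 'rV[R]_d -> R[i]) - f)]]].

Definition open_espace : set_system E :=
  [set O | forall f, O f -> nbhs_espace f O].

Lemma nbhs_espace_filter (f : E) : Filter (nbhs_espace f).
Proof.
split=> [F [FF _]|P Q HP HQ F HF|P Q PQ HP F HF].
- exact: (@filterT _ _ FF).
- by have [FF _] := HF; apply: (@filterI _ _ FF); [exact: HP|exact: HQ].
- by have [FF _] := HF; apply: (@filterS _ _ FF _ _ PQ); exact: HP.
Qed.

Lemma open_espaceT : open_espace setT.
Proof. by move=> f _; exact: (@filterT _ _ (nbhs_espace_filter f)). Qed.

Lemma open_espaceI : setI_closed open_espace.
Proof.
move=> A B oA oB f [Af Bf].
by apply: (@filterI _ _ (nbhs_espace_filter f)); [exact: oA|exact: oB].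
Qed.

Lemma open_espace_bigU (I : Type) (F : I -> set E) :
  (forall i, open_espace (F i)) -> open_espace (\bigcup_i F i).
Proof.
move=> oF f [i _ Fif].
by apply: (@filterS _ _ (nbhs_espace_filter f)) (oF i f Fif) => g; exists i.
Qed.

HB.instance Definition _ := isOpenTopological.Build E
  open_espaceT open_espaceI open_espace_bigU.

End espace_topology.

Section infinite_order_operators.
Context (R : realType) (d : nat).
Implicit Types (U : set 'rV[R]_d) (f : 'rV[R]_d -> R[i]).
Implicit Types (a : mindex d -> R[i]) (tau sigma : R).

Definition coef_bounded tau sigma (L A : R) a : Prop :=
  forall alpha : mindex d, let n : R := (mdeg alpha)%:R in
    cmod (a alpha) <=
      A * (L `^ (n `^ sigma) / n `^ (tau * 2 `^ (sigma - 1) * n `^ sigma)).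

Definition coef_bound (c : uclass) tau sigma a : Prop :=
  match c with
  | Beurling => exists L A, [/\ 0 < L, 0 < A & coef_bounded tau sigma L A a]
  | Roumieu => forall L, 0 < L -> exists2 A, 0 < A & coef_bounded tau sigma L A a
  end.

Definition infop_converges U a f : Prop :=
  forall x, U x ->
    summable [set: mindex d] (fun alpha => (cmod (a alpha * mpartial alpha f x))%:E).

Definition infop_term a f (x : 'rV[R]_d) (k : nat) : R[i] :=
  \sum_(alpha \in [set alpha : mindex d | mdeg alpha = k])
    a alpha * mpartial alpha f x.

(* P(d) f on U, extended by 0: the sum over k = |alpha| from 0 to infinity,
   the limit being taken componentwise in C. *)
Definition infop U a f : 'rV[R]_d -> R[i] := fun x =>
  if x \in U then
    (limn (series (@complex.Re R \o infop_term a f x))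
      +i* limn (series (@complex.Im R \o infop_term a f x)))%C
  else 0.

Definition infop_maps U a (X Y : set ('rV[R]_d -> R[i])) : Prop :=
  forall f, X f -> infop_converges U a f /\ Y (infop U a f).

End infinite_order_operators.

(* Main.v *)
Require Import Defs.
From HB Require Import structures.
From mathcomp Require Import all_boot all_order all_algebra.
From mathcomp Require Import complex.
From mathcomp Require Import all_classical all_reals all_analysis.
From mathcomp Require Import ring lra.

Import Order.TTheory GRing.Theory Num.Theory numFieldNormedType.Exports.
Local Open Scope classical_set_scope.
Local Open Scope ring_scope.

Set Implicit Arguments.
Unset Strict Implicit.

(** Write w_h(n) = h^(n^sigma) n^(tau n^sigma).  If |d^alpha f| <= M w_h(|alpha|)
    on a set, the terms of d^beta (P f) = sum_alpha a_alpha d^(alpha+beta) f are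
    at most M |a_alpha| w_h(n + m), with n = |alpha| and m = |beta|.  So
    everything rests on separating n from m in w_h(n + m).

    Suppose (n + m)^sigma <= p n^sigma + q m^sigma for all n and m.  Since
    n^sigma ln (1 + m/n) is at most n^sigma + m^sigma, replacing ln (n + m) by
    ln n in front of n^sigma and by ln m in front of m^sigma costs only factors
    C^(n^sigma) C^(m^sigma), which are absorbed in the parameter h.  Hence
    w_h(n + m) is at most the product of the weights of n and m with tau p and
    tau q in place of tau and some H in place of h: each h > 0 has such an H,
    and each H > 0 has such an h (weight_split_Roumieu, weight_split_Beurling).
    If tau p is at most the exponent tau0 2^(sigma-1) in the decay of a_alpha,
    the product of n^(tau p n^sigma) and n^(- tau0 2^(sigma-1) n^sigma) is at
    most 1, and there remains (L H)^(n^sigma), which is below any prescribed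
    geometric sequence in n when L H is small: in the Beurling case H may be taken small, in the Roumieu
    case L may.  This is the inequality coef_dom.  It makes the series of all
    derivatives converge absolutely and locally uniformly, and bounds
    d^beta (P f) by a multiple of M times the weight of |beta| for the pair
    tau q, H.

    The choice p = q = 2^(sigma-1) (convexity of the power function) maps
    E_tau into E_(tau 2^(sigma-1)), and any E_tau' into E_infty if the
    coefficients satisfy the bound for tau'.  When only
    tau' < tau 2^(sigma-1) is known, p = tau 2^(sigma-1) / tau' > 1 is
    admissible with some large q, and the image lies in E_(tau' q).

    The bound is linear in M and involves only the points of one compact set K.
    In the projective limit h -> 0 this is continuity.  In the inductive limit
    h -> oo a neighbourhood W of 0 is pulled back to the set of the u on K with
    P u in W; this requires P to act on E_(tau,sigma,h)(K), including the
    continuous extension of all derivatives up to the boundary of K, where the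
    smoothness of that boundary enters. *)

(** * Weights *)

Section weights.
Context {R : realType}.
Implicit Types (tau sigma h p q : R) (n m : nat).

Lemma powR_expR (x c : R) : 0 < x -> x `^ c = expR (c * ln x).
Proof. by move=> x0; rewrite /powR gt_eqF. Qed.

Lemma powR_weight sigma (c : R) n : sigma != 0 ->
  n%:R `^ (c * n%:R `^ sigma) = expR (c * n%:R `^ sigma * ln n%:R) :> R.
Proof.
move=> s0; case: n => [|n]; last by rewrite powR_expR.
by rewrite (powR0 s0) mulr0 mul0r powRr0 expR0.
Qed.

Lemma eweightE tau sigma h n : sigma != 0 -> 0 < h ->
  eweight tau sigma h n = expR (n%:R `^ sigma * (ln h + tau * ln n%:R)).
Proof.
move=> s0 h0; rewrite /eweight powR_weight // powR_expR // -expRD.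
by congr expR; ring.
Qed.

Lemma eweight_gt0 tau sigma h n : sigma != 0 -> 0 < h ->
  0 < eweight tau sigma h n.
Proof. by move=> s0 h0; rewrite eweightE // expR_gt0. Qed.

Lemma eweight_le tau sigma h h' n : sigma != 0 -> 0 < h -> h <= h' ->
  eweight tau sigma h n <= eweight tau sigma h' n.
Proof.
move=> s0 h0 hh'; have h'0 := lt_le_trans h0 hh'.
by rewrite !eweightE // ler_expR ler_wpM2l ?powR_ge0 // lerD2r ler_ln.
Qed.

Definition pow_split sigma p q := forall n m : nat,
  (n + m)%:R `^ sigma <= p * n%:R `^ sigma + q * m%:R `^ sigma :> R.

Lemma pow_split_convex sigma : 1 <= sigma ->
  pow_split sigma (2 `^ (sigma - 1)) (2 `^ (sigma - 1)).
Proof.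
move=> s1 n m; have s0 : 0 <= sigma by exact: le_trans s1.
have pos k : (k%:R : R) \in (`[0, +oo[%classic : set R).
  by rewrite inE /= in_itv /= andbT.
have h0 : 0 <= 2^-1 :> R by lra.
have h1 : 2^-1 <= 1 :> R by lra.
have : (2^-1 * n%:R + 2^-1 * m%:R) `^ sigma <=
    2^-1 * n%:R `^ sigma + 2^-1 * m%:R `^ sigma :> R.
  have := convex_powR s1 (Itv01 h0 h1) (pos n) (pos m).
  rewrite convRE [X in X `^ _ <= _]convRE /=; have -> : unstable.onem 2^-1 = 2^-1 :> R.
    by rewrite /unstable.onem; lra.
  by [].
rewrite -!mulrDr -natrD powRM ?invr_ge0 // -[2^-1](@powR_inv1 _ 2) // -powRrM.
rewrite mulN1r.
have -> : 2 `^ (-1) = 2 `^ (- sigma) * 2 `^ (sigma - 1) :> R.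
  by rewrite -powRD ?pnatr_eq0 ?implybT //; congr (_ `^ _); ring.
by rewrite -mulrA ler_pM2l ?powR_gt0 // mulrDr.
Qed.

(** If m <= delta n then (n + m)^sigma <= (1 + delta)^sigma n^sigma, which is
    p n^sigma for the right delta; otherwise n < m / delta and m^sigma alone
    dominates. *)
Lemma pow_split_above sigma p : 1 <= sigma -> 1 < p ->
  exists2 q, 0 < q & pow_split sigma p q.
Proof.
move=> s1 p1; have s0 : 0 < sigma by exact: lt_le_trans s1.
pose delta := p `^ sigma^-1 - 1.
have d0 : 0 < delta.
  have : 1 `^ sigma^-1 < p `^ sigma^-1.
    by rewrite gt0_ltr_powR ?invr_gt0 ?nnegrE // ltW // (lt_trans _ p1).
  by rewrite powR1 subr_gt0.
exists ((1 + delta^-1) `^ sigma).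
  by rewrite powR_gt0 // addr_gt0 // invr_gt0.
move=> n m; rewrite natrD.
have [mn|nm] := leP (m%:R : R) (delta * n%:R).
  apply: (@le_trans _ _ (p * n%:R `^ sigma)); last first.
    by rewrite lerDl mulr_ge0 ?powR_ge0.
  have -> : p = (1 + delta) `^ sigma.
    rewrite /delta addrC subrK -powRrM mulVf ?gt_eqF // powRr1 //.
    exact/ltW/(lt_trans _ p1).
  rewrite -powRM ?ler0n //; last by rewrite addr_ge0 // ltW.
  apply: ge0_ler_powR; rewrite ?nnegrE ?(ltW s0) ?addr_ge0 ?ler0n //.
    by rewrite mulr_ge0 ?ler0n // addr_ge0 // ltW.
  by rewrite mulrDl mul1r lerD2l.
apply: (@le_trans _ _ ((1 + delta^-1) `^ sigma * m%:R `^ sigma)); last first.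
  by rewrite lerDr mulr_ge0 ?powR_ge0 // ltW // (lt_trans _ p1).
rewrite -powRM ?ler0n //; last by rewrite addr_ge0 // invr_ge0 ltW.
apply: ge0_ler_powR; rewrite ?nnegrE ?(ltW s0) ?addr_ge0 ?ler0n //.
  by rewrite mulr_ge0 ?ler0n // addr_ge0 // invr_ge0 ltW.
by rewrite mulrDl mul1r addrC lerD2l mulrC ler_pdivlMr // mulrC ltW.
Qed.

(** ln (1 + m/n) <= m/n, and n^sigma times m/n is n^(sigma-1) m, at most the
    larger of n^sigma and m^sigma. *)
Lemma powR_mul_ln_addn_le sigma n m : 1 <= sigma ->
  n%:R `^ sigma * ln (n + m)%:R <=
    n%:R `^ sigma * ln n%:R + n%:R `^ sigma + m%:R `^ sigma :> R.
Proof.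
move=> s1; have s0 : 0 < sigma by exact: lt_le_trans s1.
case: n => [|n].
  by rewrite powR0 ?gt_eqF // !mul0r !add0r powR_ge0.
set N : R := n.+1%:R; have N0 : 0 < N by rewrite ltr0n.
have -> : (n.+1 + m)%:R = N * (1 + m%:R / N) :> R.
  by rewrite natrD mulrDr mulr1 mulrCA divff ?mulr1 ?gt_eqF.
have mN0 : 0 <= m%:R / N by rewrite divr_ge0 ?ler0n ?ltW.
rewrite lnM ?posrE //; last by rewrite ltr_pwDl.
rewrite mulrDr -addrA lerD2l.
have le1 : ln (1 + m%:R / N) <= m%:R / N.
  by have := @le_ln1Dx R (m%:R / N); apply; apply: lt_le_trans mN0; lra.
have [mn|nm] := leqP m n.+1.
  apply: (@le_trans _ _ (N `^ sigma)); last by rewrite lerDl powR_ge0.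
  rewrite -[leRHS]mulr1 ler_wpM2l ?powR_ge0 // (le_trans le1) //.
  by rewrite ler_pdivrMr // mul1r ler_nat.
apply: (@le_trans _ _ (m%:R `^ sigma)); last by rewrite lerDr powR_ge0.
apply: le_trans (ler_wpM2l (powR_ge0 _ _) le1) _.
have -> : N `^ sigma = N `^ (sigma - 1) * N.
  by rewrite -[X in _ * X]powRr1 ?ltW // -powRD ?subrK // gt_eqF ?implybT.
rewrite -mulrA [N * _]mulrC divfK ?gt_eqF //.
have m0 : 0 < (m%:R : R) by rewrite ltr0n; case: m nm {mN0 le1}.
have -> : m%:R `^ sigma = m%:R `^ (sigma - 1) * m%:R :> R.
  by rewrite -[X in _ * X]powRr1 ?ltW // -powRD ?subrK // gt_eqF ?implybT.
rewrite ler_wpM2r ?ler0n //.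
apply: ge0_ler_powR; rewrite ?nnegrE ?subr_ge0 ?ler0n ?(ltW N0) //.
by rewrite ler_nat ltnW.
Qed.

Definition weight_split sigma tau p q h H := forall n m,
  eweight tau sigma h (n + m) <=
    eweight (tau * p) sigma H n * eweight (tau * q) sigma H m.

Section fixed.
Context (sigma tau p q : R).
Hypotheses (s1 : 1 < sigma) (t0 : 0 < tau) (p0 : 0 < p) (q0 : 0 < q).
Hypothesis pq : pow_split sigma p q.

(* The constant tau (p + q) collects the errors committed in replacing
   ln (n + m) by ln n and by ln m. *)
Let weight_split_ln h H : 0 < h -> 0 < H ->
  (forall n m, (n + m)%:R `^ sigma * ln h <=
    (n%:R `^ sigma + m%:R `^ sigma) * (ln H - tau * (p + q))) ->
  weight_split sigma tau p q h H.
Proof.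
move=> h0 H0 hH n m; have s0 : sigma != 0 by rewrite gt_eqF // (lt_trans _ s1).
rewrite !eweightE // -expRD ler_expR.
have := hH n m; have := pq n m.
have := powR_mul_ln_addn_le n m (ltW s1).
have := powR_mul_ln_addn_le m n (ltW s1).
rewrite [(m + n)%N]addnC.
set N := n%:R `^ sigma; set Q := m%:R `^ sigma; set S := (n + m)%:R `^ sigma.
have : 0 <= ln (n + m)%:R :> R.
  by case: (n + m)%N => [|k]; [rewrite ln0 | rewrite ln_ge0 // ler1n].
move: (ln (n + m)%:R) (ln n%:R) (ln m%:R) => l ln lm l0 Ql Nl Spq Sh.
have H1 : tau * (S * l) <= tau * ((p * N + q * Q) * l).
  by rewrite ler_wpM2l ?(ltW t0) // ler_wpM2r.
have H2 : tau * p * (N * l) <= tau * p * (N * ln + N + Q).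
  by rewrite ler_wpM2l // ltW // mulr_gt0.
have H3 : tau * q * (Q * l) <= tau * q * (Q * lm + Q + N).
  by rewrite ler_wpM2l // ltW // mulr_gt0.
lra.
Qed.

Let split_le1 n m : n%:R `^ sigma + m%:R `^ sigma <= 2 * (n + m)%:R `^ sigma :> R.
Proof.
have s0 : 0 <= sigma by rewrite ltW // (lt_trans _ s1).
have A : n%:R `^ sigma <= (n + m)%:R `^ sigma :> R.
  by apply: ge0_ler_powR; rewrite ?nnegrE ?ler0n // ler_nat leq_addr.
have B : m%:R `^ sigma <= (n + m)%:R `^ sigma :> R.
  by apply: ge0_ler_powR; rewrite ?nnegrE ?ler0n // ler_nat leq_addl.
lra.
Qed.

(** For h >= 1 the factor h^((n+m)^sigma) is bounded with
    (n+m)^sigma <= p n^sigma + q m^sigma; the maximum with 0 reduces to that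
    case. *)
Lemma weight_split_Roumieu h : 0 < h ->
  exists2 H, 0 < H & weight_split sigma tau p q h H.
Proof.
move=> h0; pose b := Num.max (ln h) 0.
exists (expR ((p + q) * b + tau * (p + q))); first exact: expR_gt0.
apply: weight_split_ln => // [|n m]; first exact: expR_gt0.
rewrite expRK addrK.
have b0 : 0 <= b by rewrite le_max lexx orbT.
have hb : ln h <= b by rewrite le_max lexx.
have := pq n m; have := powR_ge0 (n%:R : R) sigma; have := powR_ge0 (m%:R : R) sigma.
have := powR_ge0 ((n + m)%:R : R) sigma.
move: (_ `^ _) (n%:R `^ _) (m%:R `^ _) => S N Q S0 Q0 N0 Spq.
apply: (@le_trans _ _ (S * b)); first by rewrite ler_wpM2l.
rewrite mulrA ler_wpM2r //; apply: (le_trans Spq).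
have : 0 <= q * N by rewrite mulr_ge0 // ltW.
have : 0 <= p * Q by rewrite mulr_ge0 // ltW.
lra.
Qed.

(** For h <= 1 a lower bound of (n+m)^sigma is needed instead, and
    (n^sigma + m^sigma) / 2 is enough; hence the factor 2 in ln h = 2 b. *)
Lemma weight_split_Beurling H : 0 < H ->
  exists2 h, 0 < h & weight_split sigma tau p q h H.
Proof.
move=> H0; pose b := Num.min (ln H - tau * (p + q)) 0.
exists (expR (2 * b)); first exact: expR_gt0.
apply: weight_split_ln => // [|n m]; first exact: expR_gt0.
rewrite expRK.
have b0 : b <= 0 by rewrite ge_min lexx orbT.
have hb : b <= ln H - tau * (p + q) by rewrite ge_min lexx.
have := split_le1 n m; have := powR_ge0 (n%:R : R) sigma; have := powR_ge0 (m%:R : R) sigma.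
move: (_ `^ _) (n%:R `^ _) (m%:R `^ _) => S N Q Q0 N0 Spq.
apply: (@le_trans _ _ ((N + Q) * b)); last by rewrite ler_wpM2l // addr_ge0.
by rewrite mulrA [S * 2]mulrC ler_wnM2r.
Qed.

End fixed.
End weights.

(** * Domination of the coefficients *)

Section coefficients.
Context {R : realType} {d : nat}.
Implicit Types (tau sigma h H L A : R) (a : mindex d -> R[i]) (c : uclass).

(** There are at most d^n multi-indices of length n, so that
    summing_ratio^|alpha|, summed over them, is at most 2^(-n); d + 1 instead of
    d covers d = 0. *)
Definition summing_ratio : R := (2 * d.+1%:R)^-1.

Lemma summing_ratio_gt0 : 0 < summing_ratio.
Proof. by rewrite invr_gt0 mulr_gt0 // ltr0n. Qed.

Lemma summing_ratio_le1 : summing_ratio <= 1.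
Proof.
rewrite invf_le1; last by rewrite mulr_gt0 // ltr0n.
by rewrite -natrM ler1n.
Qed.

(** The only property of the coefficients used for convergence and for the
    estimates: multiplication by |a_alpha| turns the weight of order |alpha| + m
    into a weight of order m, with a summable factor in alpha. *)
Definition coef_dom a tau tau2 sigma h H A := forall (alpha : mindex d) m,
  cmod (a alpha) * eweight tau sigma h (mdeg alpha + m) <=
    A * summing_ratio ^+ mdeg alpha * eweight tau2 sigma H m.

Lemma coef_dom_split a tau0 tau sigma p q h H L A : 1 < sigma ->
  0 < L -> 0 < H -> 0 < A -> L * H <= summing_ratio ->
  tau * p <= tau0 * 2 `^ (sigma - 1) ->
  coef_bounded tau0 sigma L A a -> weight_split sigma tau p q h H ->
  coef_dom a tau (tau * q) sigma h H A.
Proof.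
move=> s1 L0 H0 A0 LH tp aL wH alpha m.
have s0 : sigma != 0 by rewrite gt_eqF // (lt_trans _ s1).
set n := mdeg alpha.
apply: le_trans (ler_wpM2l (cmod_ge0 _) (wH n m)) _.
rewrite mulrA ler_wpM2r ?mulr_ge0 ?powR_ge0 //.
apply: le_trans (ler_wpM2r (eweight_ge0 _ _ _ _) (aL alpha)) _.
rewrite -/n -[leLHS]mulrA ler_wpM2l ?(ltW A0) //.
rewrite powR_weight // eweightE // powR_expR // -expRN -!expRD.
rewrite -[summing_ratio]lnK ?posrE ?summing_ratio_gt0 // -expRM_natl ler_expR.
have lnr : ln summing_ratio <= 0 by rewrite ln_le0 // summing_ratio_le1.
have lnLH : ln L + ln H <= ln summing_ratio.
  by rewrite -lnM ?posrE // ler_ln ?posrE ?summing_ratio_gt0 // mulr_gt0.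
have ln0 : 0 <= ln n%:R :> R.
  by case: n => [|k]; [rewrite ln0 | rewrite ln_ge0 // ler1n].
have nN : n%:R <= n%:R `^ sigma :> R.
  case: n {ln0} => [|k]; first exact: powR_ge0.
  by rewrite le1r_powR ?ler1n // ltW.
have := powR_ge0 (n%:R : R) sigma.
move: (n%:R `^ sigma) nN => N nN N0.
apply: (@le_trans _ _ (N * ln summing_ratio)); last by rewrite ler_wnM2r.
have : N * (ln L + ln H) <= N * ln summing_ratio by rewrite ler_wpM2l.
have : (tau * p) * (N * ln n%:R) <= tau0 * 2 `^ (sigma - 1) * (N * ln n%:R).
  by rewrite ler_wpM2r // mulr_ge0.
lra.
Qed.

Lemma coef_dom_Beurling a tau0 tau sigma p q : 1 < sigma -> 0 < tau ->
  0 < p -> 0 < q -> pow_split sigma p q ->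
  tau * p <= tau0 * 2 `^ (sigma - 1) -> coef_bound Beurling tau0 sigma a ->
  forall H, 0 < H -> exists h A,
    [/\ 0 < h, 0 < A & coef_dom a tau (tau * q) sigma h H A].
Proof.
move=> s1 t0 p0 q0 pq tp [L [A [L0 A0 aL]]] H H0.
pose H' := Num.min H (summing_ratio / L).
have H'0 : 0 < H' by rewrite lt_min H0 divr_gt0 // summing_ratio_gt0.
have [h h0 hH] := weight_split_Beurling s1 t0 p0 q0 pq H'0.
exists h, A; split=> // alpha m.
apply: (@le_trans _ _ (A * summing_ratio ^+ mdeg alpha * eweight (tau * q) sigma H' m)).
  apply: (coef_dom_split s1 L0 H'0 A0 _ tp aL hH).
  by rewrite mulrC -ler_pdivlMr // ge_min lexx orbT.
rewrite ler_wpM2l ?mulr_ge0 ?exprn_ge0 ?(ltW summing_ratio_gt0) ?(ltW A0) //.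
by rewrite eweight_le // ?ge_min ?lexx // gt_eqF // (lt_trans _ s1).
Qed.

Lemma coef_dom_Roumieu a tau0 tau sigma p q : 1 < sigma -> 0 < tau ->
  0 < p -> 0 < q -> pow_split sigma p q ->
  tau * p <= tau0 * 2 `^ (sigma - 1) -> coef_bound Roumieu tau0 sigma a ->
  forall h, 0 < h -> exists H A,
    [/\ 0 < H, 0 < A & coef_dom a tau (tau * q) sigma h H A].
Proof.
move=> s1 t0 p0 q0 pq tp aL h h0.
have [H H0 hH] := weight_split_Roumieu s1 t0 p0 q0 pq h0.
have L0 : 0 < summing_ratio / H by rewrite divr_gt0 // summing_ratio_gt0.
have [A A0 {}aL] := aL _ L0.
exists H, A; split=> //; apply: (coef_dom_split s1 L0 H0 A0 _ tp aL hH).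
by rewrite divfK // gt_eqF.
Qed.

End coefficients.

(** * Dominated series *)

Section dominated_series.
Context {R : realType}.
Implicit Types (u M : nat -> R).

Lemma cvg_series_dominated u M : (forall k, `|u k| <= M k) ->
  cvgn (series M) -> cvgn (series u).
Proof.
move=> uM cM; apply: normed_cvg.
by apply: (series_le_cvg _ _ uM cM) => k //; exact: le_trans (uM k).
Qed.

Lemma series_tail_le u M N : (forall k, `|u k| <= M k) -> cvgn (series M) ->
  `|limn (series u) - series u N| <= limn (series M) - series M N.
Proof.
move=> uM cM; have cu := cvg_series_dominated uM cM.
have cc (v : nat -> R) : cvgn (series v) ->
    (fun n => series v n - series v N) @ \oo --> limn (series v) - series v N.
  by move=> cv; apply: cvgB => //; exact: cvg_cst.
rewrite -(cvg_lim _ (cc _ cM)) // -(cvg_lim _ (cvg_norm (cc _ cu))) //.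
apply: ler_lim.
- by apply/cvg_ex; eexists; exact: (cvg_norm (cc _ cu)).
- by apply/cvg_ex; eexists; exact: (cc _ cM).
near=> n; have Nn : (N <= n)%N by near: n; exists N.
rewrite !sub_series_geq //.
by apply: le_trans (ler_norm_sum _ _ _) _; exact: ler_sum.
Unshelve. all: by end_near. Qed.

Lemma lim_series_le_dominated u M : (forall k, `|u k| <= M k) ->
  cvgn (series M) -> `|limn (series u)| <= limn (series M).
Proof.
move=> uM cM; have := series_tail_le 0 uM cM.
by rewrite /series /= !big_nat !big_pred0_eq // !subr0.
Qed.

(** Tannery's theorem, for an arbitrary filter: it gives the continuity of a
    dominated series (filter of neighbourhoods, possibly within a compact set)
    as well as its differentiability (difference quotients, punctured
    neighbourhoods of 0). *)
Lemma tannery (T : Type) (F : set_system T) {FF : Filter F}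
    (u : T -> nat -> R) (l : nat -> R) M :
  (forall k, (u ^~ k) @ F --> l k) ->
  (\forall y \near F, forall k, `|u y k| <= M k) ->
  (forall k, `|l k| <= M k) ->
  cvgn (series M) ->
  (fun y => limn (series (u y))) @ F --> limn (series l).
Proof.
move=> ul uM lM cM.
apply/cvgrPdist_le => e e0.
have e3 : 0 < e / 3 by lra.
have /cvgrPdist_le/(_ _ e3)[N _ /(_ N (leqnn N)) HN] := cM.
have tail : limn (series M) - series M N <= e / 3.
  exact: le_trans (ler_norm _) HN.
have part : (fun y => series (u y) N) @ F --> series l N.
  by apply: (cvg_big add_continuous) => k _; exact: ul.
have /cvgrPdist_le/(_ _ e3) part3 := part.
near=> y.
have uMy : forall k, `|u y k| <= M k by near: y.
have py : `|series l N - series (u y) N| <= e / 3 by near: y.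
have H1 := le_trans (series_tail_le N lM cM) tail.
have H2 := le_trans (series_tail_le N uMy cM) tail.
move: H1 H2 py; rewrite !ler_norml; lra.
Unshelve. all: by end_near. Qed.

Lemma is_cvg_series_half (C : R) : cvgn (series (geometric C 2^-1)).
Proof. by apply/cvgP/cvg_geometric_series; rewrite ger0_norm; lra. Qed.

End dominated_series.

(** * Symmetry of mixed partial derivatives *)

Section mixed_partials.
Context {R : realType} {d : nat}.
Local Notation V := 'rV[R]_d.
Implicit Types (u : V -> R) (x v w : V).

Lemma is_derive_line u x v (t : R) : derivable u (x + t *: v) v ->
  is_derive t 1 (fun r => u (x + r *: v)) ('D_v u (x + t *: v)).
Proof.
have E : (fun h : R => h^-1 *: (((fun r => u (x + r *: v)) \o shift t) (h *: 1) -
      u (x + t *: v))) =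
    (fun h => h^-1 *: ((u \o shift (x + t *: v)) (h *: v) - u (x + t *: v))).
  apply/funext => h /=; congr (_ *: (u _ - _)).
  by rewrite -[h *: 1]/(h * 1) mulr1 scalerDl addrCA.
by move=> du; split; rewrite /derivable /derive E.
Qed.

Lemma mean_value_line u x v (t : R) : 0 <= t ->
  (forall r, 0 <= r <= t -> derivable u (x + r *: v) v) ->
  exists2 r, 0 <= r <= t & u (x + t *: v) - u x = t * 'D_v u (x + r *: v).
Proof.
move=> t0 du.
have [||r] := @MVT_segment R (fun r => u (x + r *: v))
  (fun r => 'D_v u (x + r *: v)) 0 t t0.
- move=> r; rewrite in_itv /= => /andP[r0 rt].
  by apply: is_derive_line; apply: du; rewrite !ltW.
- apply: derivable_within_continuous => r; rewrite in_itv /= => rt.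
  by have [] := is_derive_line (du r rt).
rewrite in_itv /= => rt; rewrite scale0r addr0 subr0 mulrC => E.
by exists r.
Qed.

Lemma near_line2 x v w (P : set V) : (\forall y \near x, P y) ->
  exists2 e : R, 0 < e & forall r s, 0 <= r <= e -> 0 <= s <= e ->
    P (x + r *: v + s *: w).
Proof.
move=> /nbhs_ballP[e /= e0 eP].
pose c := `|v| + `|w| + 1.
have c0 : 0 < c by rewrite ltr_wpDl // addr_ge0.
exists (e / 2 / c) => [|r s /andP[r0 re] /andP[s0 se]].
  by rewrite !divr_gt0.
apply: eP; rewrite -ball_normE /= -addrA opprD addrA subrr add0r normrN.
apply: le_lt_trans (ler_normD _ _) _; rewrite !normrZ !ger0_norm //.
apply: (@le_lt_trans _ _ (e / 2 / c * c)); last first.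
  by rewrite divfK ?gt_eqF //; lra.
apply: (@le_trans _ _ (e / 2 / c * (`|v| + `|w|))).
  by rewrite mulrDr lerD // ler_wpM2r.
by rewrite ler_wpM2l ?lerDl // !divr_ge0 // ltW.
Qed.

(** The mean value theorem in the direction v, applied to the increment
    y |-> u (y + t w) - u y, and then in the direction w to the derivative. *)
Lemma second_difference u x v w :
  (\forall y \near x, derivable u y v /\ derivable ('D_v u) y w) ->
  exists2 e : R, 0 < e & forall t, 0 < t <= e ->
  exists r s, [/\ 0 <= r <= t, 0 <= s <= t &
    (u (x + t *: v + t *: w) - u (x + t *: v)) - (u (x + t *: w) - u x)
      = t * (t * 'D_w ('D_v u) (x + r *: v + s *: w))].
Proof.
move=> /(near_line2 v w)[e e0 H]; exists e => // t /andP[t0 te].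
pose g y := u (y + t *: w) - u y.
have lin r : 0 <= r <= t -> 0 <= r <= e.
  by move=> /andP[-> /le_trans]; exact.
have te' : 0 <= t <= e by rewrite ltW.
have z0 : 0 <= (0 : R) <= e by rewrite lexx ltW.
have dsh y : derivable u (y + t *: w) v ->
    is_derive y v (fun y => u (y + t *: w)) ('D_v u (y + t *: w)).
  have E : (fun h : R => h^-1 *: (((fun y => u (y + t *: w)) \o shift y) (h *: v)
        - u (y + t *: w))) =
      (fun h => h^-1 *: ((u \o shift (y + t *: w)) (h *: v) - u (y + t *: w))).
    by apply/funext => h /=; rewrite addrA.
  by move=> du; split; rewrite /derivable /derive E.
have du1 r : 0 <= r <= t -> derivable u (x + r *: v) v.
  by move=> /lin rt; have [] := H r 0 rt z0; rewrite scale0r addr0.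
have du2 r : 0 <= r <= t -> derivable u (x + r *: v + t *: w) v.
  by move=> /lin rt; have [] := H r t rt te'.
have dg r : 0 <= r <= t -> is_derive (x + r *: v) v g
    ('D_v u (x + r *: v + t *: w) - 'D_v u (x + r *: v)).
  move=> rt; apply: is_deriveB; first exact/dsh/du2.
  exact/derivableP/du1.
have [|r rt Er] := @mean_value_line g x v t (ltW t0).
  by move=> r /dg[].
have [_ Dg] := dg r rt.
have [|s st Es] := @mean_value_line ('D_v u) (x + r *: v) w t (ltW t0).
  by move=> s /lin st; have [] := H r s (lin r rt) st.
exists r, s; split=> //.
by rewrite -Es -Dg -Er.
Qed.

(** The second difference is symmetric in v and w, so by second_difference
    each value of one mixed derivative at some point close to x is a value of
    the other at another such point; continuity at x concludes. *)
Lemma mixed_partialsC u x v w :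
  (\forall y \near x, [/\ derivable u y v, derivable u y w,
     derivable ('D_v u) y w & derivable ('D_w u) y v]) ->
  {for x, continuous ('D_w ('D_v u))} -> {for x, continuous ('D_v ('D_w u))} ->
  'D_w ('D_v u) x = 'D_v ('D_w u) x.
Proof.
move=> H c1 c2; apply/eqP; rewrite -subr_eq0 -normr_le0; apply/ler_addgt0Pl => e e0.
rewrite addr0.
have [|e1 e10 H1] := @second_difference u x v w.
  by apply: filterS H => y [].
have [|e2 e20 H2] := @second_difference u x w v.
  by apply: filterS H => y [].
have e22 : 0 < e / 2 by lra.
have /cvgrPdist_le/(_ _ e22)/(near_line2 v w)[e3 e30 H3] := c1.
have /cvgrPdist_le/(_ _ e22)/(near_line2 w v)[e4 e40 H4] := c2.
pose t := Num.min (Num.min e1 e2) (Num.min e3 e4).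
have t0 : 0 < t by rewrite !lt_min e10 e20 e30 e40.
have [t1 t2 t3 t4] : [/\ t <= e1, t <= e2, t <= e3 & t <= e4].
  by split; rewrite !ge_min lexx ?orbT.
have [|r [s [/andP[r0 rt] /andP[s0 st] E1]]] := H1 t; first by rewrite t0.
have [|r' [s' [/andP[r'0 r't] /andP[s'0 s't] E2]]] := H2 t; first by rewrite t0.
have {}H3 := H3 r s; have {}H4 := H4 r' s'.
rewrite r0 s0 (le_trans rt t3) (le_trans st t3) in H3.
rewrite r'0 s'0 (le_trans r't t4) (le_trans s't t4) in H4.
have {H3} := H3 isT isT; have {H4} := H4 isT isT.
have -> : 'D_v ('D_w u) (x + r' *: w + s' *: v) =
          'D_w ('D_v u) (x + r *: v + s *: w).
  apply: (mulfI (lt0r_neq0 t0)); apply: (mulfI (lt0r_neq0 t0)).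
  apply: etrans (esym E2) _; apply: etrans E1; rewrite (addrAC x (t *: w)).
  move: (u (x + t *: v + t *: w)) (u (x + t *: v)) (u (x + t *: w)) (u x).
  by move=> a b b' a'; ring.
move: ('D_w ('D_v u) (x + _ + _)) ('D_w ('D_v u) x) ('D_v ('D_w u) x).
move=> b a a' H4 H3; apply: le_trans (ler_distD b _ _) _.
by rewrite [leRHS]splitr; apply: lerD => //; rewrite distrC.
Qed.

End mixed_partials.

(*BEGIN*)
(** * Smooth functions and series of smooth functions on an open set *)

Section smooth_on_open.
Context {R : realType} {d : nat}.
Local Notation V := 'rV[R]_d.
Implicit Types (A : set V) (g : V -> R) (s t : seq 'I_d) (x y : V).

Lemma iter_partial_cat s t g :
  iter_partial (s ++ t) g = iter_partial s (iter_partial t g).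
Proof. by elim: s => //= i s ->. Qed.

Lemma iter_partial0 s : iter_partial s (cst 0 : V -> R) = cst 0.
Proof. by elim: s => //= i s ->; apply/funext => x; rewrite derive_cst. Qed.

Lemma smooth_real_at A g s x : smooth_real A g -> A x ->
  {for x, continuous (iter_partial s g)} /\
  forall i, derivable (iter_partial s g) x (delta_mx 0 i).
Proof. by move=> sg Ax; exact: (nbhs_singleton (sg s x Ax)). Qed.

Lemma smooth_realP A g : open A ->
  (forall s x, A x -> {for x, continuous (iter_partial s g)} /\
     forall i, derivable (iter_partial s g) x (delta_mx 0 i)) ->
  smooth_real A g.
Proof.
move=> oA sg s x Ax; have := open_nbhs_nbhs (conj oA Ax).
by apply: filterS => y /sg.
Qed.

Lemma smooth_real_iter A g t : smooth_real A g ->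
  smooth_real A (iter_partial t g).
Proof. by move=> sg s x /(sg (s ++ t)); rewrite iter_partial_cat. Qed.

Lemma eq_iter_partial A g g' s x : open A -> (forall y, A y -> g y = g' y) ->
  A x -> iter_partial s g x = iter_partial s g' x.
Proof.
move=> oA E; elim: s x => [|i s IH] x Ax /=; first exact: E.
apply: near_eq_derive.
by have := open_nbhs_nbhs (conj oA Ax); apply: filterS => y /IH.
Qed.

Lemma eq_smooth_real A g g' : open A -> (forall y, A y -> g y = g' y) ->
  smooth_real A g -> smooth_real A g'.
Proof.
move=> oA E sg; apply: smooth_realP => // s x Ax.
have [cg dg] := smooth_real_at s sg Ax.
have Es : \forall y \near x, iter_partial s g y = iter_partial s g' y.
  have := open_nbhs_nbhs (conj oA Ax).
  by apply: filterS => y; exact: eq_iter_partial.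
split=> [|i]; last exact: near_eq_derivable Es (dg i).
rewrite /prop_for /continuous_at -(nbhs_singleton Es).
exact: cvg_trans (near_eq_cvg Es) cg.
Qed.

Lemma iter_partial_front A g i s1 s2 x : open A -> smooth_real A g -> A x ->
  iter_partial (s1 ++ i :: s2) g x = iter_partial (i :: s1 ++ s2) g x.
Proof.
move=> oA sg; elim: s1 x => [//|j s1 IH] x Ax /=.
have oAx := open_nbhs_nbhs (conj oA Ax).
rewrite (@near_eq_derive _ _ _ _ (iter_partial (i :: s1 ++ s2) g)); last first.
  by apply: filterS oAx => y /IH.
apply: mixed_partialsC.
- apply: filterS oAx => y Ay.
  have D s := (smooth_real_at s sg Ay).2.
  by split; [exact: D|exact: D|exact: (D (i :: _))|exact: (D (j :: _))].
- exact: (smooth_real_at [:: j, i & s1 ++ s2] sg Ax).1.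
- exact: (smooth_real_at [:: i, j & s1 ++ s2] sg Ax).1.
Qed.

(** The derivatives of smooth functions depend on the multiset of directions
    only.  Lists can therefore replace multi-indices, and alpha + beta becomes
    concatenation. *)
Lemma iter_partial_perm A g s t x : open A -> smooth_real A g -> A x ->
  perm_eq s t -> iter_partial s g x = iter_partial t g x.
Proof.
move=> oA sg; elim: s t x => [|i s IH] t x Ax st.
  by move: (perm_size st); case: t {st}.
have it : i \in t by rewrite -(perm_mem st) mem_head.
case/splitPr: it st => t1 t2; rewrite perm_sym -cat1s perm_catCA /= perm_cons.
rewrite perm_sym => st; rewrite (iter_partial_front _ _ _ oA sg Ax) /=.
apply: near_eq_derive; have := open_nbhs_nbhs (conj oA Ax).
by apply: filterS => y Ay; exact: IH.
Qed.

(** Increments of either sign, as they occur in two-sided difference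
    quotients. *)
Lemma mean_value_line_sym (u : V -> R) x v (h : R) :
  (forall r, `|r| <= `|h| -> derivable u (x + r *: v) v) ->
  exists2 r, `|r| <= `|h| & u (x + h *: v) - u x = h * 'D_v u (x + r *: v).
Proof.
move=> du; have [h0|h0] := leP 0 h.
  have [r /andP[r0 rh]|r /andP[r0 rh] E] := mean_value_line (u:=u) (x:=x) (v:=v) h0.
    by apply: du; rewrite !ger0_norm.
  by exists r => //; rewrite !ger0_norm.
have nh0 : 0 <= - h by rewrite oppr_ge0 ltW.
have S r : x + h *: v + r *: v = x + (h + r) *: v by rewrite scalerDl addrA.
have B r : 0 <= r <= - h -> `|h + r| <= `|h|.
  move=> /andP[r0 rh]; rewrite !ler0_norm ?(ltW h0) //; lra.
have [r /B|r /B rh] := mean_value_line (u:=u) (x:=x + h *: v) (v:=v) nh0.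
  by rewrite S; exact: du.
rewrite !S addrN scale0r addr0 => E; exists (h + r) => //.
by rewrite -opprB E mulNr opprK.
Qed.

Section series.
Variables (A : set V) (g : nat -> V -> R).
Hypotheses (oA : open A) (sg : forall k, smooth_real A (g k)).
Hypothesis bounded : forall s x, A x -> exists2 M : nat -> R, cvgn (series M) &
  \forall y \near x, forall k, `|iter_partial s (g k) y| <= M k.

Let G s x := limn (series (fun k => iter_partial s (g k) x)).

Let cvgG s x : A x -> cvgn (series (fun k => iter_partial s (g k) x)).
Proof.
by move=> Ax; have [M cM /nbhs_singleton bM] := bounded s Ax;
  exact: cvg_series_dominated cM.
Qed.

Let contG s x : A x -> {for x, continuous (G s)}.
Proof.
move=> Ax; have [M cM bM] := bounded s Ax.
apply: (@tannery _ _ (nbhs x) (nbhs_filter x) (fun y k => iter_partial s (g k) y) _ M) => // [k|].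
  exact: (smooth_real_at s (sg k) Ax).1.
exact: (nbhs_singleton bM).
Qed.

(* The difference quotients of the terms are dominated by the mean value
   theorem, so their sum passes to the limit. *)
Let deriveG s x i : A x -> is_derive x (delta_mx 0 i) (G s) (G (i :: s) x).
Proof.
move=> Ax; have [M cM bM] := bounded (i :: s) Ax.
set v : V := delta_mx 0 i.
pose q h k := h^-1 *: (iter_partial s (g k) (h *: v + x) - iter_partial s (g k) x).
have [e e0 He] : exists2 e : R, 0 < e & forall r, `|r| <= e ->
    A (x + r *: v) /\ forall k, `|iter_partial (i :: s) (g k) (x + r *: v)| <= M k.
  have /nbhs_ballP[e /= e0 eP] : \forall y \near x, A y /\ forall k,
      `|iter_partial (i :: s) (g k) y| <= M k.
    by apply: filterI bM; exact: open_nbhs_nbhs.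
  exists (e / 2 / (`|v| + 1)) => [|r re].
    by rewrite !divr_gt0 // ltr_wpDl.
  apply: eP; rewrite -ball_normE /= opprD addrA subrr add0r normrN normrZ.
  apply: (@le_lt_trans _ _ (e / 2 / (`|v| + 1) * (`|v| + 1))).
    by rewrite ler_pM // lerDl.
  by rewrite divfK ?gt_eqF ?ltr_wpDl //; lra.
have near_e : \forall h \near (0 : R)^', h != 0 /\ `|h| <= e.
  near=> h; split; near: h; first exact: nbhs_dnbhs_neq.
  apply: nbhs_dnbhs; apply/nbhs_ballP; exists e => //= h.
  by rewrite -ball_normE /= sub0r normrN => /ltW.
have : (fun h => limn (series (q h))) @ 0^' --> G (i :: s) x.
  apply: (tannery (u := q) (M := M)) => // [k||]; last exact: (nbhs_singleton bM).
    exact: (smooth_real_at s (sg k) Ax).2.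
  apply: filterS near_e => h [h0 he] k.
  have [r rh|r rh E] := @mean_value_line_sym (iter_partial s (g k)) x v h.
    have HA := (He r (le_trans rh he)).1.
    exact: (smooth_real_at s (sg k) HA).2.
  rewrite /q [h *: v + x]addrC E /GRing.scale /= mulKf //.
  exact: (He r (le_trans rh he)).2.
move=> lim_q.
have qE : \forall h \near 0^', limn (series (q h)) =
    h^-1 *: ((G s \o shift x) (h *: v) - G s x).
  have near_A : \forall h \near (0 : R)^', A (h *: v + x).
    apply: filterS near_e => h [_ he].
    by rewrite addrC; have [] := He h he.
  apply: filterS near_A => h Ah /=.
  apply: cvg_lim => //.
  have -> : series (q h) = (fun n => h^-1 *:
      (series (fun k => iter_partial s (g k) (h *: v + x)) n -
       series (fun k => iter_partial s (g k) x) n)).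
    by apply/funext => n; rewrite /series /= -sumrB scaler_sumr.
  by apply: cvgZr; apply: cvgB; exact: cvgG.
have lim_G : (fun h => h^-1 *: ((G s \o shift x) (h *: v) - G s x)) @ 0^'
    --> G (i :: s) x.
  exact: cvg_trans (near_eq_cvg qE) lim_q.
split; first by apply/cvg_ex; eexists; exact: lim_G.
exact: cvg_lim lim_G.
Unshelve. all: by end_near. Qed.

Lemma iter_partial_series s x : A x ->
  iter_partial s (fun y => limn (series (g ^~ y))) x =
  limn (series (fun k => iter_partial s (g k) x)).
Proof.
elim: s x => [//|i s IH] x Ax /=.
rewrite (@near_eq_derive _ _ _ _ (G s)); last first.
  by have := open_nbhs_nbhs (conj oA Ax); apply: filterS => y /IH.
by have [_ ->] := deriveG s i Ax.
Qed.

Lemma smooth_real_series : smooth_real A (fun y => limn (series (g ^~ y))).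
Proof.
apply: smooth_realP => // s x Ax.
have E : \forall y \near x, G s y =
    iter_partial s (fun y => limn (series (g ^~ y))) y.
  have := open_nbhs_nbhs (conj oA Ax).
  by apply: filterS => y Ay; rewrite iter_partial_series.
split=> [|i].
  rewrite /prop_for /continuous_at -(nbhs_singleton E).
  apply: (cvg_trans (near_eq_cvg E)); exact: (contG Ax).
by apply: near_eq_derivable E _; have [] := deriveG s i Ax.
Qed.

End series.
End smooth_on_open.

(*BEGIN*)
(** * Multi-indices *)

Section multi_indices.
Context {d : nat}.
Implicit Types (s : seq 'I_d) (alpha : mindex d).

Lemma count_mseq alpha i : count_mem i (mseq alpha) = alpha i.
Proof.
rewrite /mseq count_flatten -map_comp sumnE big_map big_enum /=.
rewrite (bigD1 i) //= count_nseq /= eqxx mul1n big1 ?addn0 // => j /negbTE ji.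
by rewrite count_nseq /= ji mul0n.
Qed.

Lemma size_mseq alpha : size (mseq alpha) = mdeg alpha.
Proof.
rewrite /mseq size_flatten /shape -map_comp sumnE big_map big_enum /=.
by apply: eq_bigr => i _; rewrite size_nseq.
Qed.

Definition multiplicities s : mindex d := [ffun i => count_mem i s].

Lemma perm_mseq_multiplicities s : perm_eq s (mseq (multiplicities s)).
Proof. by apply/allP => i _ /=; rewrite count_mseq ffunE. Qed.

Lemma mdeg_multiplicities s : mdeg (multiplicities s) = size s.
Proof. by rewrite -size_mseq (perm_size (perm_mseq_multiplicities s)). Qed.

Lemma mseqK : cancel (@mseq d) multiplicities.
Proof. by move=> alpha; apply/ffunP => i; rewrite ffunE count_mseq. Qed.

(** The multi-indices of length k, enumerated through the lists of k directions;
    this gives the crude cardinality bound d^k directly. *)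
Definition monos k : seq (mindex d) :=
  undup [seq multiplicities (val t) | t <- enum {: k.-tuple 'I_d}].

Lemma mem_monos k alpha : (alpha \in monos k) = (mdeg alpha == k).
Proof.
rewrite mem_undup; apply/mapP/eqP => [[t _ ->]|ak].
  by rewrite mdeg_multiplicities size_tuple.
have sz : size (mseq alpha) == k by rewrite size_mseq ak.
by exists (Tuple sz); rewrite ?mem_enum //= mseqK.
Qed.

Lemma size_monos k : (size (monos k) <= d ^ k)%N.
Proof.
by rewrite (leq_trans (size_undup _)) // size_map -cardE card_tuple card_ord.
Qed.

Lemma monosE k : [set` monos k] = [set alpha | mdeg alpha = k].
Proof.
by apply/seteqP; split=> alpha /=; rewrite mem_monos => /eqP.
Qed.

End multi_indices.

(** * The operator on families of derivatives *)

Section jets.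
Context {R : realType} {d : nat}.
Local Notation V := 'rV[R]_d.
Local Notation jet := (seq 'I_d -> R[i]).
Implicit Types (a : mindex d -> R[i]) (z : jet) (s : seq 'I_d) (x y : V).
Implicit Types (tau sigma h H M A : R).

Lemma Re_le_cmod (w : R[i]) : `|complex.Re w| <= cmod w.
Proof.
rewrite /cmod normc_def /= -sqrtr_sqr ler_sqrt ?lerDl ?sqr_ge0 //.
by rewrite addr_ge0 ?sqr_ge0.
Qed.

Lemma cmod_le_ReIm (w : R[i]) : cmod w <= `|complex.Re w| + `|complex.Im w|.
Proof.
rewrite /cmod normc_def /= -[leRHS]ger0_norm ?addr_ge0 // -sqrtr_sqr.
rewrite ler_sqrt ?sqr_ge0 // sqrrD !real_normK ?num_real //.
by rewrite lerD2r lerDl mulrn_wge0 // mulr_ge0.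
Qed.

Lemma cmodM_le (w w' : R[i]) : cmod (w * w') <= cmod w * cmod w'.
Proof.
have := cmod_lin w w' 0; rewrite addr0 => /le_trans; apply.
by rewrite /cmod normr0 addr0.
Qed.

Lemma cmod_sum_le (I : Type) (r : seq I) (F G : I -> R[i]) :
  cmod (\sum_(i <- r) F i * G i) <= \sum_(i <- r) cmod (F i) * cmod (G i).
Proof.
elim: r => [|i r IH]; first by rewrite !big_nil /cmod normr0.
by rewrite !big_cons (le_trans (cmod_lin _ _ _)) // lerD2l.
Qed.

Lemma cmod_mulNi (w : R[i]) : cmod (- 'i%C * w) = cmod w.
Proof.
rewrite /cmod !normc_def; case: w => p q /=.
by congr Num.sqrt; rewrite !expr2; ring.
Qed.

Lemma Im_ReNi (w : R[i]) : complex.Im w = complex.Re (- 'i%C * w).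
Proof. by case: w => p q /=; ring. Qed.

(** The part of order k in the coefficients of d^s (P f), for a family z of
    numbers standing for the derivatives of f at a point.  The family need not
    come from a function: at the boundary of a compact set it consists of
    limits of derivatives. *)
Definition jet_sum a z s k : R[i] :=
  \sum_(alpha <- monos k) a alpha * z (s ++ mseq alpha).

(** Imaginary parts are real parts for the coefficients - i a_alpha, which have
    the same moduli; the analysis is therefore done for real parts only. *)
Lemma Im_jet_sum a z s k : complex.Im (jet_sum a z s k) =
  complex.Re (jet_sum (fun alpha => - 'i%C * a alpha) z s k).
Proof.
rewrite Im_ReNi mulr_sumr; congr complex.Re.
by apply: eq_bigr => alpha _; rewrite mulrA.
Qed.

Definition jet_le tau sigma h M z :=
  forall s, cmod (z s) <= M * eweight tau sigma h (size s).

Lemma coef_dom_mulNi a tau tau2 sigma h H A :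
  coef_dom a tau tau2 sigma h H A ->
  coef_dom (fun alpha => - 'i%C * a alpha) tau tau2 sigma h H A.
Proof. by move=> aA alpha m; rewrite cmod_mulNi. Qed.

Section bounds.
Context (a : mindex d -> R[i]) (tau tau2 sigma h H A M : R) (z : jet).
Hypotheses (A0 : 0 <= A) (M0 : 0 <= M).
Hypothesis aA : coef_dom a tau tau2 sigma h H A.
Hypothesis zM : jet_le tau sigma h M z.

Lemma jet_sum_terms_le s k :
  \sum_(alpha <- monos k) cmod (a alpha) * cmod (z (s ++ mseq alpha)) <=
    geometric (M * A * eweight tau2 sigma H (size s)) (2^-1) k.
Proof.
set w := eweight _ _ _ _; have w0 : 0 <= w by exact: eweight_ge0.
apply: (@le_trans _ _ (\sum_(alpha <- monos k) M * A * w * @summing_ratio R d ^+ k)).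
  rewrite [leLHS]big_seq [leRHS]big_seq; apply: ler_sum => alpha.
  rewrite mem_monos.
  move=> /eqP ak; apply: (le_trans (ler_wpM2l (cmod_ge0 _) (zM _))).
  have -> : M * A * w * @summing_ratio R d ^+ k = M * (A * @summing_ratio R d ^+ k * w).
    by ring.
  rewrite mulrCA ler_wpM2l // size_cat size_mseq addnC -ak; exact: aA.
rewrite big_const_seq count_predT iter_addr_0 /geometric /= -[leLHS]mulr_natr -[leLHS]mulrA.
rewrite ler_wpM2l //; first by rewrite mulr_ge0 // mulr_ge0.
apply: (@le_trans _ _ (@summing_ratio R d ^+ k * d.+1%:R ^+ k)); last first.
  rewrite -exprMn /summing_ratio invfM -mulrA mulVf ?mulr1 ?pnatr_eq0 //.
rewrite ler_wpM2l ?exprn_ge0 ?(ltW summing_ratio_gt0) // -natrX ler_nat.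
by apply: leq_trans (size_monos k) _; case: k => // k; rewrite leq_exp2r.
Qed.

Lemma Re_jet_sum_le s k : `|complex.Re (jet_sum a z s k)| <=
  geometric (M * A * eweight tau2 sigma H (size s)) (2^-1) k.
Proof.
apply: le_trans (Re_le_cmod _) _; apply: le_trans (cmod_sum_le _ _ _) _.
exact: jet_sum_terms_le.
Qed.

Lemma Re_jet_series_le s :
  `|limn (series (fun k => complex.Re (jet_sum a z s k)))| <=
    2 * (M * A * eweight tau2 sigma H (size s)).
Proof.
have cg := @cvg_geometric_series R (M * A * eweight tau2 sigma H (size s)) 2^-1.
have h1 : `|2^-1| < 1 :> R by rewrite ger0_norm; lra.
have := lim_series_le_dominated (Re_jet_sum_le s) _.
move=> /(_ (cvgP _ (cg h1))); rewrite (cvg_lim _ (cg h1)) //.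
have -> : 1 - 2^-1 = 2^-1 :> R by lra.
by rewrite invrK [_ * 2]mulrC.
Qed.

End bounds.
End jets.

(** * Smoothness and estimates of P f on an open set *)

Section operator.
Context {R : realType} {d : nat}.
Local Notation V := 'rV[R]_d.
Implicit Types (f : V -> R[i]) (a : mindex d -> R[i]) (s : seq 'I_d) (x y : V).
Implicit Types (tau sigma h H M A : R).

Definition jet f x s : R[i] := (iter_partial s (@complex.Re R \o f) x
  +i* iter_partial s (@complex.Im R \o f) x)%C.

Lemma infop_termE a f x k : infop_term a f x k = jet_sum a (jet f x) [::] k.
Proof.
rewrite /infop_term -monosE -fsbig_seq //; exact: undup_uniq.
Qed.

Lemma jet_perm (Om : set V) f x s t : open Om -> smooth Om f -> Om x ->
  perm_eq s t -> jet f x s = jet f x t.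
Proof.
move=> oOm [sr si] Ox st; rewrite /jet (iter_partial_perm oOm sr Ox st).
by rewrite (iter_partial_perm oOm si Ox st).
Qed.

Section termwise.
Context (Om : set V) (f : V -> R[i]).
Hypotheses (oOm : open Om) (sf : smooth Om f).

(** The terms of P f are finite linear combinations of real derivatives of Re f
    and Im f, so they may be differentiated term by term. *)
Lemma Re_combination (a : mindex d -> R[i]) (r : seq (mindex d)) :
  let F x := complex.Re (\sum_(alpha <- r) a alpha * mpartial alpha f x) in
  smooth_real Om F /\ forall s x, Om x -> iter_partial s F x =
    complex.Re (\sum_(alpha <- r) a alpha * jet f x (s ++ mseq alpha)).
Proof.
have [sr si] := sf; elim: r => [|alpha r [IHs IHd]] /=.
  have E : (fun x => complex.Re (\sum_(alpha <- [::])
      a alpha * mpartial alpha f x)) = cst 0.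
    by apply/funext => x; rewrite big_nil.
  rewrite E; split=> [|s x _]; first exact: smooth_real0.
  by rewrite big_nil iter_partial0.
pose Fr := @complex.Re R \o f; pose Fi := @complex.Im R \o f.
pose F x := complex.Re (\sum_(alpha <- r) a alpha * mpartial alpha f x).
set F' := (fun x => _).
have -> : F' = 1 \*: (complex.Re (a alpha) \*: iter_partial (mseq alpha) Fr
    + (- complex.Im (a alpha)) \*: iter_partial (mseq alpha) Fi) + 1 \*: F.
  apply/funext => x; rewrite /F' big_cons raddfD /= /F /mpartial !fctE.
  by case: (a alpha) => p q /=; rewrite /GRing.scale /= !mul1r mulNr.
have sr' := smooth_real_iter (mseq alpha) sr.
have si' := smooth_real_iter (mseq alpha) si.
have sri := smooth_real_lin (complex.Re (a alpha)) (- complex.Im (a alpha)) sr' si'.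
split=> [|s x Ox]; first exact: (smooth_real_lin 1 1 sri IHs).
rewrite (nbhs_singleton (iter_partial_lin _ _ sri IHs s Ox)).
rewrite (nbhs_singleton (iter_partial_lin _ _ sr' si' s Ox)).
rewrite IHd // big_cons raddfD /= /jet !iter_partial_cat.
by case: (a alpha) => p q /=; rewrite !mul1r mulNr.
Qed.

Context (a : mindex d -> R[i]) (tau tau2 sigma : R).
(* The parameters may vary from point to point, as they do with the compact
   sets in the definition of the classes. *)
Hypothesis loc : forall x, Om x -> exists h H A M,
  [/\ 0 <= A, 0 <= M, coef_dom a tau tau2 sigma h H A &
    \forall y \near x, jet_le tau sigma h M (jet f y)].

Let g (b : mindex d -> R[i]) k x :=
  complex.Re (\sum_(alpha <- monos k) b alpha * mpartial alpha f x).

Let S b x := limn (series (g b ^~ x)).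

Let smooth_S b : (forall tau tau2 sigma h H A,
    coef_dom a tau tau2 sigma h H A -> coef_dom b tau tau2 sigma h H A) ->
  smooth_real Om (S b) /\ forall s x, Om x -> iter_partial s (S b) x =
    limn (series (fun k => complex.Re (jet_sum b (jet f x) s k))).
Proof.
move=> ab; have sg k := (Re_combination b (monos k)).1.
have dg k := (Re_combination b (monos k)).2.
have bg s x : Om x -> exists2 N : nat -> R, cvgn (series N) &
    \forall y \near x, forall k, `|iter_partial s (g b k) y| <= N k.
  move=> Ox; have [h [H [A [M [A0 M0 /ab bA fM]]]]] := loc Ox.
  exists (geometric (M * A * eweight tau2 sigma H (size s)) 2^-1).
    exact: is_cvg_series_half.
  have := open_nbhs_nbhs (conj oOm Ox) => oOx.
  apply: filterS (filterI oOx fM) => y [Oy fMy] k.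
  by rewrite dg //; exact: (Re_jet_sum_le A0 M0 bA fMy).
split; first exact: smooth_real_series sg bg.
move=> s x Ox; rewrite (iter_partial_series oOm sg bg) //.
by congr (limn (series _)); apply/funext => k; rewrite dg.
Qed.

Let Re_infop x : Om x -> (@complex.Re R \o infop Om a f) x = S a x.
Proof.
move=> Ox; rewrite /infop /= mem_set //=.
by congr (limn (series _)); apply/funext => k /=; rewrite infop_termE.
Qed.

Let Im_infop x : Om x -> (@complex.Im R \o infop Om a f) x =
  S (fun alpha => - 'i%C * a alpha) x.
Proof.
move=> Ox; rewrite /infop /= mem_set //=.
congr (limn (series _)); apply/funext => k /=.
by rewrite infop_termE Im_jet_sum.
Qed.

Lemma smooth_infop : smooth Om (infop Om a f).
Proof.
split.
  apply: (eq_smooth_real oOm (fun y Oy => esym (Re_infop Oy))).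
  exact: (smooth_S _).1.
apply: (eq_smooth_real oOm (fun y Oy => esym (Im_infop Oy))).
exact: (smooth_S (@coef_dom_mulNi _ _ _)).1.
Qed.

Lemma jet_infop s x : Om x -> jet (infop Om a f) x s =
  (limn (series (fun k => complex.Re (jet_sum a (jet f x) s k)))
   +i* limn (series (fun k => complex.Im (jet_sum a (jet f x) s k))))%C.
Proof.
move=> Ox; rewrite /jet (eq_iter_partial _ oOm Re_infop Ox).
rewrite (eq_iter_partial _ oOm Im_infop Ox) (smooth_S _).2 //.
rewrite (smooth_S (@coef_dom_mulNi _ _ _)).2 //.
by congr (_ +i* limn (series _))%C; apply/funext => k; rewrite Im_jet_sum.
Qed.

(** Bounding the real and the imaginary part by the sum 2 of the geometric
    series gives the factor 4. *)
Lemma infop_jet_le h H A M x : 0 <= A -> 0 <= M -> Om x ->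
  coef_dom a tau tau2 sigma h H A -> jet_le tau sigma h M (jet f x) ->
  jet_le tau2 sigma H (4 * M * A) (jet (infop Om a f) x).
Proof.
move=> A0 M0 Ox aA fM s; rewrite jet_infop //.
apply: le_trans (cmod_le_ReIm _) _ => /=.
have -> : 4 * M * A * eweight tau2 sigma H (size s) =
    2 * (M * A * eweight tau2 sigma H (size s)) +
    2 * (M * A * eweight tau2 sigma H (size s)) by ring.
apply: lerD; first exact: Re_jet_series_le aA fM _.
have -> : (fun k => complex.Im (jet_sum a (jet f x) s k)) =
    (fun k => complex.Re (jet_sum (fun alpha => - 'i%C * a alpha) (jet f x) s k)).
  by apply/funext => k; exact: Im_jet_sum.
exact: Re_jet_series_le (coef_dom_mulNi aA) fM _.
Qed.

Lemma infop_convergesT : infop_converges Om a f.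
Proof.
move=> x Ox; have [h [H [A [M [A0 M0 aA /nbhs_singleton fM]]]]] := loc Ox.
rewrite /summable.
set u := (fun alpha => `|(cmod (a alpha * mpartial alpha f x))%:E|%E).
have -> : [set: mindex d] = \bigcup_k [set alpha | mdeg alpha = k].
  by apply/seteqP; split=> // alpha _; exists (mdeg alpha).
have u0 alpha : (0 <= u alpha)%E by exact: abse_ge0.
rewrite nneseries_sum_bigcup //; last first.
  by apply/trivIsetP => i j _ _ /eqP ij; apply/seteqP; split => // alpha [/= -> /ij].
pose C := M * A * eweight tau2 sigma H 0.
have uC k : (\esum_(alpha in [set alpha | mdeg alpha = k]) u alpha <=
    (geometric C 2^-1 k)%:E)%E.
  rewrite -monosE esum_fset //; last exact: finite_seq.
  rewrite -fsbig_seq ?undup_uniq //.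
  apply: le_trans (_ : ((\sum_(alpha <- monos k) cmod (a alpha)
      * cmod (jet f x ([::] ++ mseq alpha)))%:E <= _)%E).
    rewrite -sumEFin; apply: lee_sum => alpha _.
    by rewrite /u gee0_abs ?lee_fin ?cmod_ge0 // cmodM_le.
  by rewrite lee_fin; exact: (jet_sum_terms_le A0 M0 aA fM).
apply: (@le_lt_trans _ _ (\sum_(0 <= k <oo) (geometric C 2^-1 k)%:E)%E).
  by apply: lee_nneseries => // k _ _; exact: esum_ge0.
have [C0 hC] : (0 <= C) /\ forall k, (geometric C 2^-1 k)%:E = (C * 2 / (2 ^ (k + 1))%:R)%:E.
  split; first by rewrite !mulr_ge0 ?powR_ge0.
  move=> k; congr EFin; rewrite /geometric /= addn1 expnS natrM exprVn natrX.
  by rewrite invfM mulrA mulfK.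
under eq_eseriesr do rewrite hC.
have := @cvg_geometric_eseries_half R (C * 2) 0.
by move=> /cvg_lim ->; rewrite ?ltry.
Qed.

End termwise.
End operator.

(*BEGIN*)
(** * Action on the classes *)

Section norms.
Context {R : realType} {d : nat}.
Local Notation V := 'rV[R]_d.
Implicit Types (A K U Om : set V) (f g : V -> R[i]) (tau sigma h H M : R).

Lemma enorm_le tau sigma h M A f : 1 < sigma -> 0 < h ->
  (forall x, A x -> jet_le tau sigma h M (jet f x)) ->
  (enorm tau sigma h A f <= M%:E)%E.
Proof.
move=> s1 h0 fM; apply: ge_ereal_sup => _ [alpha [x [Ax ->]]].
have s0 : sigma != 0 by rewrite gt_eqF // (lt_trans _ s1).
rewrite lee_fin ler_pdivrMr ?eweight_gt0 //.
by have := fM x Ax (mseq alpha); rewrite size_mseq.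
Qed.

(** Norms involve one ordering of each derivative; symmetry of mixed partial
    derivatives extends the bound to every list of directions. *)
Lemma jet_le_enorm tau sigma h M Om A f : 1 < sigma -> 0 < h ->
  open Om -> smooth Om f -> A `<=` Om ->
  (forall alpha x, A x ->
     cmod (mpartial alpha f x) / eweight tau sigma h (mdeg alpha) <= M) ->
  forall x, A x -> jet_le tau sigma h M (jet f x).
Proof.
move=> s1 h0 oOm sf AOm fM x Ax s.
have s0 : sigma != 0 by rewrite gt_eqF // (lt_trans _ s1).
rewrite (jet_perm oOm sf (AOm x Ax) (perm_mseq_multiplicities s)).
rewrite -mdeg_multiplicities -ler_pdivrMr ?eweight_gt0 //.
exact: fM.
Qed.

Lemma enorm_fin_jet_le tau sigma h Om A f : 1 < sigma -> 0 < h ->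
  open Om -> smooth Om f -> A `<=` Om -> (enorm tau sigma h A f < +oo)%E ->
  exists2 M, 0 <= M & forall x, A x -> jet_le tau sigma h M (jet f x).
Proof.
move=> s1 h0 oOm sf AOm /enorm_finP[M fM]; exists (Num.max M 0).
  by rewrite le_max lexx orbT.
apply: (jet_le_enorm s1 h0 oOm sf AOm) => alpha x Ax.
by rewrite le_max fM.
Qed.

Lemma enorm_lt_jet_le tau sigma h M Om A f : 1 < sigma -> 0 < h ->
  open Om -> smooth Om f -> A `<=` Om -> (enorm tau sigma h A f < M%:E)%E ->
  forall x, A x -> jet_le tau sigma h M (jet f x).
Proof.
move=> s1 h0 oOm sf AOm fM.
apply: (jet_le_enorm s1 h0 oOm sf AOm) => alpha x Ax.
rewrite -lee_fin; apply/ltW/le_lt_trans/fM.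
by apply: ereal_sup_ubound; exists alpha, x.
Qed.

Lemma compact_nbhs U x : open U -> U x ->
  exists K, [/\ compact K, K `<=` U & nbhs x K].
Proof.
move=> oU Ux; have /nbhs_closedballP[r rU] := open_nbhs_nbhs (conj oU Ux).
exists (closed_ball x r%:num); split=> //.
  apply: bounded_closed_compact; last exact: closed_ball_closed.
  rewrite closed_ballE //; exists (`|x| + r%:num); split; first exact: num_real.
  move=> N rN y /=; rewrite /closed_ball_ /= => xy; apply: ltW.
  apply: le_lt_trans rN; rewrite -[y](subrK x) -normrN addrC.
  by rewrite opprD opprB (le_trans (ler_normD _ _)) // normrN lerD.
apply: filterS (@subset_closed_ball _ _ _ _) _.
exact: nbhsx_ballx.
Qed.

End norms.

Section action.
Context {R : realType} {d : nat} (tau0 tau sigma p q : R) (c : uclass).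
Context (a : mindex d -> R[i]) (U : set 'rV[R]_d).
Hypotheses (openU : open U) (s1 : 1 < sigma) (t0 : 0 < tau).
Hypotheses (p0 : 0 < p) (q0 : 0 < q) (pq : pow_split sigma p q).
Hypotheses (tp : tau * p <= tau0 * 2 `^ (sigma - 1)).
Hypothesis a_bound : coef_bound c tau0 sigma a.
Implicit Types (K : set 'rV[R]_d) (f : 'rV[R]_d -> R[i]) (h H A M : R).

Lemma eclass_loc f x : eclass c tau sigma U f -> U x -> exists h H A M,
  [/\ 0 <= A, 0 <= M, coef_dom a tau (tau * q) sigma h H A &
    \forall y \near x, jet_le tau sigma h M (jet f y)].
Proof.
move=> [sf _ fb] Ux; have [K [cK KU xK]] := compact_nbhs openU Ux.
have := fb K cK KU; case: c a_bound => /= ab Kb.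
  have [h [A [h0 A0 aA]]] := coef_dom_Beurling s1 t0 p0 q0 pq tp ab ltr01.
  have [M M0 fM] := enorm_fin_jet_le s1 h0 openU sf KU (Kb h h0).
  by exists h, 1, A, M; split=> //; [exact: ltW | exact: filterS xK].
have [h h0 Kh] := Kb.
have [H [A [H0 A0 aA]]] := coef_dom_Roumieu s1 t0 p0 q0 pq tp ab h0.
have [M M0 fM] := enorm_fin_jet_le s1 h0 openU sf KU Kh.
by exists h, H, A, M; split=> //; [exact: ltW | exact: filterS xK].
Qed.

(** The order of the choices is what distinguishes the two cases: in the
    Beurling case the target parameter H comes first and h is small enough, in
    the Roumieu case h is given by f and H is large enough. *)
Lemma infop_maps_eclass :
  infop_maps U a (eclass c tau sigma U) (eclass c (tau * q) sigma U).
Proof.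
move=> f Ef; have loc x := @eclass_loc f x Ef.
have [sf _ fb] := Ef.
split; first exact: infop_convergesT loc.
split; first exact: smooth_infop loc.
  by move=> x Ux; rewrite /infop memNset.
move=> K cK KU; have := fb K cK KU; case: c a_bound => /= ab Kb.
  move=> H H0.
  have [h [A [h0 A0 aA]]] := coef_dom_Beurling s1 t0 p0 q0 pq tp ab H0.
  have [M M0 fM] := enorm_fin_jet_le s1 h0 openU sf KU (Kb h h0).
  apply: le_lt_trans (ltry (4 * M * A)); apply: enorm_le => // x Kx.
  exact: (infop_jet_le openU sf loc (ltW A0) M0 (KU _ Kx) aA (fM _ Kx)).
have [h h0 Kh] := Kb.
have [H [A [H0 A0 aA]]] := coef_dom_Roumieu s1 t0 p0 q0 pq tp ab h0.
have [M M0 fM] := enorm_fin_jet_le s1 h0 openU sf KU Kh.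
exists H => //; apply: le_lt_trans (ltry (4 * M * A)); apply: enorm_le => // x Kx.
exact: (infop_jet_le openU sf loc (ltW A0) M0 (KU _ Kx) aA (fM _ Kx)).
Qed.

End action.

(*BEGIN*)
(** * Linearity *)

Section linearity.
Context {R : realType} {d : nat}.
Local Notation V := 'rV[R]_d.
Implicit Types (K Om : set V) (f g : V -> R[i]) (u v : V -> R) (l m : R[i]).

Lemma comb_lin f g l m : l *: f + m *: g = l *: f + ((m - 1) *: g + g).
Proof. by rewrite scalerBl scale1r subrK. Qed.

Lemma mpartial_comb Om f g l m (alpha : mindex d) x :
  smooth Om f -> smooth Om g -> Om x ->
  mpartial alpha (l *: f + m *: g) x =
    l * mpartial alpha f x + m * mpartial alpha g x.
Proof.
move=> sf sg Ox; rewrite comb_lin.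
have sg' := smooth_lin (m - 1) sg sg.
by rewrite (mpartial_lin _ _ sf sg' Ox) (mpartial_lin _ _ sg sg Ox); ring.
Qed.

Definition infop_cvg (a : mindex d -> R[i]) f x :=
  cvgn (series (@complex.Re R \o infop_term a f x)) /\
  cvgn (series (@complex.Im R \o infop_term a f x)).

Lemma infop_comb Om (a : mindex d -> R[i]) f g l m x :
  smooth Om f -> smooth Om g -> Om x -> infop_cvg a f x -> infop_cvg a g x ->
  infop Om a (l *: f + m *: g) x = l * infop Om a f x + m * infop Om a g x.
Proof.
move=> sf sg Ox [cfr cfi] [cgr cgi]; rewrite /infop mem_set //.
have E k : infop_term a (l *: f + m *: g) x k =
    l * infop_term a f x k + m * infop_term a g x k.
  rewrite /infop_term -!monosE -!fsbig_seq ?undup_uniq // !mulr_sumr -big_split.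
  by apply: eq_bigr => alpha _ /=; rewrite (mpartial_comb _ _ _ sf sg Ox); ring.
move: (infop_term a f x) (infop_term a g x) cfr cfi cgr cgi E.
move=> F G cfr cfi cgr cgi E.
have cvg4 (b1 b2 b3 b4 : R) : series (fun k => b1 * complex.Re (F k) +
      b2 * complex.Im (F k) + (b3 * complex.Re (G k) + b4 * complex.Im (G k))) @ \oo
    --> b1 * limn (series (@complex.Re R \o F)) +
      b2 * limn (series (@complex.Im R \o F)) +
      (b3 * limn (series (@complex.Re R \o G)) +
      b4 * limn (series (@complex.Im R \o G))).
  have -> : series (fun k => b1 * complex.Re (F k) +
      b2 * complex.Im (F k) + (b3 * complex.Re (G k) + b4 * complex.Im (G k))) =
      (fun n => b1 * series (@complex.Re R \o F) n +
      b2 * series (@complex.Im R \o F) n +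
      (b3 * series (@complex.Re R \o G) n +
      b4 * series (@complex.Im R \o G) n)).
    by apply/funext => n; rewrite /series /= !mulr_sumr -!big_split.
  by apply: cvgD; apply: cvgD; apply: cvgMr.
case: l m E => [l1 l2] [m1 m2] E.
have -> : @complex.Re R \o infop_term a (Complex l1 l2 *: f + Complex m1 m2 *: g) x =
    (fun k => l1 * complex.Re (F k) + - l2 * complex.Im (F k) +
      (m1 * complex.Re (G k) + - m2 * complex.Im (G k))).
  apply/funext => k; rewrite /= E; case: (F k) (G k) => [? ?] [? ?] /=.
  by rewrite !mulNr.
have -> : @complex.Im R \o infop_term a (Complex l1 l2 *: f + Complex m1 m2 *: g) x =
    (fun k => l2 * complex.Re (F k) + l1 * complex.Im (F k) +
      (m2 * complex.Re (G k) + m1 * complex.Im (G k))).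
  apply/funext => k; rewrite /= E; case: (F k) (G k) => [? ?] [? ?] /=.
  by ring.
rewrite (cvg_lim _ (cvg4 _ _ _ _)) // (cvg_lim _ (cvg4 _ _ _ _)) //.
apply/eqP; rewrite eq_complex /=; apply/andP; split; apply/eqP; ring.
Qed.

Lemma infop_cvg_dom (a : mindex d -> R[i]) (tau tau2 sigma h H A M : R) f x :
  0 <= A -> 0 <= M -> coef_dom a tau tau2 sigma h H A ->
  jet_le tau sigma h M (jet f x) -> infop_cvg a f x.
Proof.
move=> A0 M0 aA fM.
have cg := @is_cvg_series_half R (M * A * eweight tau2 sigma H 0).
split; apply: cvg_series_dominated cg => k /=; rewrite infop_termE.
  exact: (Re_jet_sum_le A0 M0 aA fM [::]).
rewrite Im_jet_sum; exact: (Re_jet_sum_le A0 M0 (coef_dom_mulNi aA) fM [::]).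
Qed.

Lemma smooth_real_upto_lin K u v (b e : R) :
  smooth_real_upto K u -> smooth_real_upto K v ->
  smooth_real_upto K (b \*: u + e \*: v).
Proof.
move=> [su eu] [sv ev]; split; first exact: smooth_real_lin.
move=> s; have [u' cu uE] := eu s; have [v' cv vE] := ev s.
exists (fun x => b * u' x + e * v' x).
  apply/subspace_continuousP => x Kx.
  by apply: cvgD; apply: cvgMr;
    [move/subspace_continuousP: cu; apply | move/subspace_continuousP: cv; apply].
move=> x Kx; rewrite uE // vE //.
by rewrite (nbhs_singleton (iter_partial_lin b e su sv s Kx)).
Qed.

Lemma smooth_upto_lin K f g l :
  smooth_upto K f -> smooth_upto K g -> smooth_upto K (l *: f + g).
Proof.
move=> [fr fi] [gr gi]; split; rewrite ?Re_lin ?Im_lin.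
  exact: (smooth_real_upto_lin _ _ (smooth_real_upto_lin _ _ fr fi) gr).
exact: (smooth_real_upto_lin _ _ (smooth_real_upto_lin _ _ fr fi) gi).
Qed.

Lemma smooth_upto_smooth K f : smooth_upto K f -> smooth K^° f.
Proof. by move=> [[sr _] [si _]]. Qed.

Lemma estep_lin tau sigma (h : R) K f g l : estep tau sigma h K f ->
  estep tau sigma h K g -> estep tau sigma h K (l *: f + g).
Proof.
move=> [sf nf] [sg ng]; split; first exact: smooth_upto_lin.
by apply: enorm_lin nf ng => //; exact: smooth_upto_smooth.
Qed.

Lemma estep_homo tau sigma (h h' : R) K f : 0 < h -> h <= h' ->
  estep tau sigma h K f -> estep tau sigma h' K f.
Proof. by move=> h0 hh' [sf nf]; split=> //; exact: (enorm_homo h0 hh' nf). Qed.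

Lemma smooth_upto_sub K Om f : K `<=` Om -> smooth Om f -> smooth_upto K f.
Proof.
move=> KO; have main u : smooth_real Om u -> smooth_real_upto K u.
  move=> su; split=> [s x /interior_subset/KO|s]; first exact: su.
  exists (iter_partial s u) => //; apply: continuous_in_subspaceT => x.
  by rewrite inE => /KO Ox; exact: (smooth_real_at s su Ox).1.
by move=> [/main ? /main ?].
Qed.

End linearity.

(** * Compact sets with smooth boundary *)

Section compact_with_boundary.
Context {R : realType} {d : nat}.
Local Notation V := 'rV[R]_d.
Implicit Types (K : set V) (u : V -> R[i]) (tau sigma h H A M : R).

(** At a boundary point a partial derivative of the defining function rho does
    not vanish, so rho < 0 at points arbitrarily near on one side along the
    coordinate axis; these points are interior. *)
Lemma smooth_boundary_closure K : smooth_boundary K -> K `<=` closure K^°.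
Proof.
move=> bK x Kx; have [K0x|K0x] := pselect (K^° x); first exact: subset_closure.
have [W [rho [oW Wx srho [i Di] KW]]] := bK x Kx K0x.
have rho_c y : W y -> {for y, continuous rho}.
  by move=> Wy; exact: (smooth_real_at [::] srho Wy).1.
have neg_int y : W y -> rho y < 0 -> K^° y.
  move=> Wy ry; have oWy := open_nbhs_nbhs (conj oW Wy).
  have : \forall z \near y, rho z < 0.
    have := rho_c y Wy; rewrite /prop_for /continuous_at => /cvgr_lt; exact.
  by move=> /(filterI oWy); apply: filterS => z [Wz rz]; apply/KW => //; exact: ltW.
have rx : rho x = 0.
  apply/eqP; rewrite eq_le; apply/andP; split; first exact/KW.
  by rewrite leNgt; apply/negP => /(neg_int _ Wx).
move=> B xB.
have dr := (smooth_real_at [::] srho Wx).2 i.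
set v := delta_mx 0 i in Di dr.
have /cvgrPdist_lt/(_ `|'D_v rho x|) : (fun h => h^-1 *:
    ((rho \o shift x) (h *: v) - rho x)) @ 0^' --> 'D_v rho x by exact: dr.
rewrite normr_gt0 => /(_ Di) near_quot.
have near_BW : \forall h \near (0 : R)^', B (h *: v + x) /\ W (h *: v + x).
  have : \forall y \near x, B y /\ W y.
    by apply: filterI xB _; exact: open_nbhs_nbhs.
  move=> BW; apply: nbhs_dnbhs.
  have : (fun h : R => h *: v + x) @ 0 --> 0 *: v + x.
    by apply: cvgD; [apply: cvgZl; exact: cvg_id | exact: cvg_cst].
  by rewrite scale0r add0r => /(_ _ BW).
have [e /= e0 He] : exists2 e : R, 0 < e & forall h : R, `|h| < e -> h != 0 ->
    [/\ `|'D_v rho x - h^-1 * (rho (h *: v + x) - rho x)| < `|'D_v rho x|,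
       B (h *: v + x) & W (h *: v + x)].
  have near3 : \forall h \near (0 : R)^',
      [/\ `|'D_v rho x - h^-1 * (rho (h *: v + x) - rho x)| < `|'D_v rho x|,
       B (h *: v + x) & W (h *: v + x)].
    by apply: filterS2 near_BW near_quot => h [? ?] ?.
  have /nbhs_ballP[e /= e0 eP] : nbhs (0 : R) _ := near3.
  exists e => // h he h0.
  by apply: (eP h _ h0); rewrite -ball_normE /= sub0r normrN.
(* Half the admissible step, against the sign of the derivative. *)
pose h : R := if 0 < 'D_v rho x then - (e / 2) else e / 2.
have h0 : h != 0 by rewrite /h; case: ifP => _; rewrite ?oppr_eq0 gt_eqF // divr_gt0.
have he : `|h| < e.
  by rewrite /h; case: ifP => _; rewrite ?normrN ger0_norm; lra.
have [Dq Bh Wh] := He h he h0.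
exists (h *: v + x); split=> //; apply: neg_int => //.
move: Dq; rewrite rx subr0 => Dq.
rewrite -[rho _](mulVKf h0); move: (h^-1 * _) Dq => r Dq {Bh Wh He he}.
rewrite /h; case: ifP => D0.
  move: Dq; rewrite (gtr0_norm D0) ltr_norml => /andP[_ Dq].
  by rewrite mulNr oppr_lt0 mulr_gt0 ?divr_gt0 //; lra.
have {}D0 : 'D_v rho x < 0 by rewrite lt_neqAle Di leNgt D0.
move: Dq; rewrite (ltr0_norm D0) ltr_norml => /andP[Dq _].
by rewrite pmulr_rlt0 ?divr_gt0 //; lra.
Qed.


Lemma within_continuous_le K (e : V -> R) (C : R) :
  {within K, continuous e} -> (forall x, K^° x -> `|e x| <= C) ->
  forall x, K x -> closure K^° x -> `|e x| <= C.
Proof.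
move=> /subspace_continuousP ce eC x Kx cKx; rewrite leNgt; apply/negP => Cx.
have : \forall y \near within K (nbhs x), C < `|e y|.
  exact: (cvgr_gt _ (cvg_norm (ce x Kx))).
move=> /cKx[y [K0y]] /(_ (interior_subset K0y)).
by rewrite ltNge eC.
Qed.

(** The extension of d^s (P u) to K is the series formed with the extensions of
    the derivatives of u.  They satisfy on K, the closure of its interior, the
    bounds known in the interior, so that series is dominated on K and its sum
    is continuous there. *)
Lemma smooth_upto_infop (a : mindex d -> R[i]) tau tau2 sigma h H A M K u :
  K `<=` closure K^° -> smooth_upto K u -> 0 <= A -> 0 <= M ->
  coef_dom a tau tau2 sigma h H A ->
  (forall x, K^° x -> jet_le tau sigma h M (jet u x)) ->
  smooth_upto K (infop K^° a u).
Proof.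
move=> Kcl su A0 M0 aA uM; have oK := @open_interior _ K.
have su0 := smooth_upto_smooth su.
have loc x : K^° x -> exists h H A M,
    [/\ 0 <= A, 0 <= M, coef_dom a tau tau2 sigma h H A &
      \forall y \near x, jet_le tau sigma h M (jet u y)].
  move=> Kx; exists h, H, A, M; split=> //.
  by have := open_nbhs_nbhs (conj oK Kx); apply: filterS => y /uM.
have [sP1 sP2] := smooth_infop oK su0 loc.
have [[_ eR] [_ eI]] := su.
have /choice[er er_P] : forall s, exists e : V -> R, {within K, continuous e} /\
    forall x, K^° x -> e x = iter_partial s (@complex.Re R \o u) x.
  by move=> s; have [e] := eR s; exists e.
have /choice[ei ei_P] : forall s, exists e : V -> R, {within K, continuous e} /\
    forall x, K^° x -> e x = iter_partial s (@complex.Im R \o u) x.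
  by move=> s; have [e] := eI s; exists e.
have er_c s := (er_P s).1; have erE s := (er_P s).2.
have ei_c s := (ei_P s).1; have eiE s := (ei_P s).2.
pose z x s : R[i] := (er s x +i* ei s x)%C.
have zE x : K^° x -> z x = jet u x.
  by move=> Kx; apply/funext => s; rewrite /z erE // eiE.
have zM x : K x -> jet_le tau sigma h (2 * M) (z x).
  move=> Kx s; apply: le_trans (cmod_le_ReIm _) _ => /=.
  have B (e : V -> R) : {within K, continuous e} ->
      (forall y, K^° y -> `|e y| <= M * eweight tau sigma h (size s)) ->
      `|e x| <= M * eweight tau sigma h (size s).
    by move=> ce eM; apply: within_continuous_le ce eM _ Kx (Kcl x Kx).
  have B1 := B _ (er_c s); have B2 := B _ (ei_c s).
  rewrite -mulrA mulr_natl mulr2n lerD //.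
    apply: B1 => y Ky; rewrite erE //.
    exact: le_trans (Re_le_cmod (jet u y s)) (uM y Ky s).
  apply: B2 => y Ky; rewrite eiE //.
  have := le_trans (Re_le_cmod (- 'i%C * jet u y s)) _.
  by rewrite -Im_ReNi cmod_mulNi; apply; exact: uM.
have M20 : 0 <= 2 * M by rewrite mulr_ge0.
have ext (b : mindex d -> R[i]) s : coef_dom b tau tau2 sigma h H A ->
    {within K, continuous (fun x =>
      limn (series (fun k => complex.Re (jet_sum b (z x) s k))))}.
  move=> bA; apply/subspace_continuousP => x Kx.
  apply: (@tannery _ _ (within K (nbhs x)) _
    (fun y k => complex.Re (jet_sum b (z y) s k)) _
    (geometric (2 * M * A * eweight tau2 sigma H (size s)) 2^-1)).
  - move=> k.
    have E y : complex.Re (jet_sum b (z y) s k) = \sum_(alpha <- monos k)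
        (complex.Re (b alpha) * er (s ++ mseq alpha) y -
         complex.Im (b alpha) * ei (s ++ mseq alpha) y).
      by rewrite raddf_sum; apply: eq_bigr => alpha _; case: (b alpha).
    under eq_cvg do rewrite E; rewrite E.
    apply: (cvg_big add_continuous) => alpha _.
    by apply: cvgB; apply: cvgMr;
      [move/subspace_continuousP: (er_c (s ++ mseq alpha)); apply
      |move/subspace_continuousP: (ei_c (s ++ mseq alpha)); apply].
  - apply: filterS (withinT K (nbhs_filter x)) => y Ky k.
    exact: (Re_jet_sum_le A0 M20 bA (zM y Ky)).
  - by move=> k; exact: (Re_jet_sum_le A0 M20 bA (zM x Kx)).
  - exact: is_cvg_series_half.
split; split=> // s.
  exists (fun x => limn (series (fun k => complex.Re (jet_sum a (z x) s k)))).
    exact: ext.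
  move=> x Kx; have := congr1 (@complex.Re R) (jet_infop oK su0 loc s Kx).
  by rewrite zE //= => ->.
exists (fun x => limn (series (fun k =>
    complex.Re (jet_sum (fun alpha => - 'i%C * a alpha) (z x) s k)))).
  exact/ext/coef_dom_mulNi.
move=> x Kx; have := congr1 (@complex.Im R) (jet_infop oK su0 loc s Kx).
rewrite zE //= => ->.
by congr (limn (series _)); apply/funext => k; rewrite Im_jet_sum.
Qed.

End compact_with_boundary.

(** * Continuity *)

Section null_functions.
Context {R : realType} {d : nat} (sigma : R).
Hypothesis s1 : 1 < sigma.
Implicit Types (K : set 'rV[R]_d) (f u : 'rV[R]_d -> R[i]) (tau h M N : R).

Lemma enorm_lin_le tau h M N K f u (l : R[i]) : 0 < h -> smooth K^° f -> smooth K^° u ->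
  (enorm tau sigma h K^° f <= M%:E)%E -> (enorm tau sigma h K^° u <= N%:E)%E ->
  (enorm tau sigma h K^° (l *: f + u)%R <= (cmod l * M + N)%:E)%E.
Proof.
move=> h0 sf su fM uN; have s0 : sigma != 0 by rewrite gt_eqF // (lt_trans _ s1).
apply: ge_ereal_sup => _ [alpha [x [Kx ->]]].
have B g B : (enorm tau sigma h K^° g <= B%:E)%E ->
    cmod (mpartial alpha g x) / eweight tau sigma h (mdeg alpha) <= B.
  by rewrite -lee_fin; apply: le_trans; apply: ereal_sup_ubound; exists alpha, x.
rewrite lee_fin (mpartial_lin _ _ sf su Kx).
have := B _ _ fM; have := B _ _ uN.
rewrite !ler_pdivrMr ?eweight_gt0 // => Bu Bf.
apply: le_trans (cmod_lin _ _ _) _.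
by rewrite mulrDl lerD // -mulrA ler_wpM2l ?cmod_ge0.
Qed.

(** Membership in E_(tau,sigma,h)(K) only depends on the values in the interior
    of K, so functions vanishing there lie in every neighbourhood of 0. *)
Lemma estep_null tau h K u : 0 < h -> (forall x, K^° x -> u x = 0) ->
  estep tau sigma h K u /\ (enorm tau sigma h K^° u <= 0%:E)%E.
Proof.
move=> h0 u0; have oK := @open_interior _ K.
have Re0 x : K^° x -> (@complex.Re R \o u) x = cst 0 x.
  by move=> Kx; rewrite /= u0.
have Im0 x : K^° x -> (@complex.Im R \o u) x = cst 0 x.
  by move=> Kx; rewrite /= u0.
have up (v : 'rV[R]_d -> R) : (forall x, K^° x -> v x = cst 0 x) ->
    smooth_real_upto K v.
  move=> v0; split=> [|s].
    by apply: (eq_smooth_real oK (fun y Ky => esym (v0 y Ky))); exact: smooth_real0.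
  exists (cst 0) => [|x Kx].
    by apply: continuous_subspaceT => x; exact: cst_continuous.
  by rewrite (eq_iter_partial s oK v0 Kx) iter_partial0.
have enorm0 : (enorm tau sigma h K^° u <= 0%:E)%E.
  apply: enorm_le => // x Kx s; rewrite mul0r /jet.
  rewrite (eq_iter_partial s oK Re0 Kx) (eq_iter_partial s oK Im0 Kx).
  by rewrite !iter_partial0 /cmod normr0.
split=> //; split; first by split; exact: up.
by apply: le_lt_trans enorm0 (ltry _).
Qed.

End null_functions.

Section continuity.
Context {R : realType} {d : nat} (tau0 tau sigma p q : R).
Context (a : mindex d -> R[i]) (U : set 'rV[R]_d).
Hypotheses (openU : open U) (s1 : 1 < sigma) (t0 : 0 < tau).
Hypotheses (p0 : 0 < p) (q0 : 0 < q) (pq : pow_split sigma p q).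
Hypotheses (tp : tau * p <= tau0 * 2 `^ (sigma - 1)).
Implicit Types (K : set 'rV[R]_d) (f u : 'rV[R]_d -> R[i]) (h H A M : R).
Implicit Types (c : uclass).

Lemma enorm_infop_le Om h H A M K u : open Om -> smooth Om u -> K^° `<=` Om ->
  (forall x, Om x -> exists h H A M,
    [/\ 0 <= A, 0 <= M, coef_dom a tau (tau * q) sigma h H A &
      \forall y \near x, jet_le tau sigma h M (jet u y)]) ->
  0 < H -> 0 <= A -> 0 <= M -> coef_dom a tau (tau * q) sigma h H A ->
  (forall x, K^° x -> jet_le tau sigma h M (jet u x)) ->
  (enorm (tau * q) sigma H K^° (infop Om a u) <= (4 * M * A)%:E)%E.
Proof.
move=> oOm su KO loc H0 A0 M0 aA uM; apply: enorm_le => // x Kx.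
exact: (infop_jet_le oOm su loc A0 M0 (KO x Kx) aA (uM x Kx)).
Qed.

Lemma nbhs0_local_infop_Beurling K (W : set ('rV[R]_d -> R[i])) :
  coef_bound Beurling tau0 sigma a -> K `<=` U -> compact K ->
  nbhs0_local Beurling (tau * q) sigma K W ->
  nbhs0_local Beurling tau sigma K
    [set u | eclass Beurling tau sigma U u -> W (infop U a u)].
Proof.
move=> ab KU cK [H [eps [H0 eps0 HW]]].
have [h [A [h0 A0 aA]]] := coef_dom_Beurling s1 t0 p0 q0 pq tp ab H0.
have K0U : K^° `<=` U by move=> x /interior_subset/KU.
exists h, (eps / (8 * A)); split=> //.
  by rewrite divr_gt0 // mulr_gt0.
move=> u _ uM Eu; have [su _ _] := Eu.
have [_ [sPu _ Pfin]] := infop_maps_eclass openU s1 t0 p0 q0 pq tp ab Eu.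
apply: HW => [H' H'0|].
  split; first exact: smooth_upto_sub sPu.
  have /enorm_finP[M HM] := Pfin K cK KU H' H'0.
  by apply/enorm_finP; exists M => alpha x /interior_subset; exact: HM.
have loc x := @eclass_loc _ _ _ _ _ _ _ _ _ _ openU s1 t0 p0 q0 pq tp ab u x Eu.
have uM' := enorm_lt_jet_le s1 h0 openU su K0U uM.
have M0 : 0 <= eps / (8 * A) by rewrite divr_ge0 ?mulr_ge0 // ltW.
have := enorm_infop_le openU su K0U loc H0 (ltW A0) M0 aA uM'.
move/le_lt_trans; apply; rewrite lte_fin.
have -> : 4 * (eps / (8 * A)) * A = eps / 2.
  by field; rewrite gt_eqF.
lra.
Qed.

Lemma estep_infop h H A M K u : 0 < H -> 0 <= A -> 0 <= M ->
  K `<=` closure K^° -> smooth_upto K u -> coef_dom a tau (tau * q) sigma h H A ->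
  (forall x, K^° x -> jet_le tau sigma h M (jet u x)) ->
  estep (tau * q) sigma H K (infop K^° a u) /\
  (enorm (tau * q) sigma H K^° (infop K^° a u) <= (4 * M * A)%:E)%E.
Proof.
move=> H0 A0 M0 Kcl su aA uM; have oK := @open_interior _ K.
have le : (enorm (tau * q) sigma H K^° (infop K^° a u) <= (4 * M * A)%:E)%E.
  apply: (enorm_infop_le oK (smooth_upto_smooth su) _ _ H0 A0 M0 aA uM) => //.
  move=> x Kx; exists h, H, A, M; split=> //.
  by have := open_nbhs_nbhs (conj oK Kx); apply: filterS => y /uM.
split=> //; split; first exact: (smooth_upto_infop Kcl su A0 M0 aA uM).
exact: le_lt_trans le (ltry _).
Qed.

Lemma infop_cvg_estep h K u x : coef_bound Roumieu tau0 sigma a -> 0 < h ->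
  estep tau sigma h K u -> K^° x -> infop_cvg a u x.
Proof.
move=> ab h0 [su nu] Kx.
have [H [A [H0 A0 aA]]] := coef_dom_Roumieu s1 t0 p0 q0 pq tp ab h0.
have oK := @open_interior _ K.
have [M M0 uM] := enorm_fin_jet_le s1 h0 oK (smooth_upto_smooth su)
  (@subset_refl _ _) nu.
exact: (infop_cvg_dom (ltW A0) M0 aA (uM x Kx)).
Qed.

(** A convex neighbourhood B need not be invariant under changes outside the
    interior of K, where P u computed on U and P u computed on K differ.
    Writing P u on U as the mean of 2 (P u on K) and of a function vanishing in
    the interior of K repairs this; hence the factor 2 in the preimage W'. *)
Lemma nbhs0_local_infop_Roumieu K (W : set ('rV[R]_d -> R[i])) :
  coef_bound Roumieu tau0 sigma a -> K `<=` U -> K `<=` closure K^° ->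
  nbhs0_local Roumieu (tau * q) sigma K W ->
  exists2 W', nbhs0_local Roumieu tau sigma K W' &
    forall u, W' u -> W (infop U a u).
Proof.
move=> ab KU Kcl [B [BW Bconv HB]].
have oK := @open_interior _ K.
pose W' := [set u | (exists2 h, 0 < h & estep tau sigma h K u) /\
                    B (2 *: infop K^° a u)].
exists W'; last first.
  move=> u [[h h0 hu] Bu]; apply: BW.
  pose z : 'rV[R]_d -> R[i] := 2 *: (infop U a u - infop K^° a u).
  have -> : infop U a u = 2^-1 *: (2 *: infop K^° a u) + 2^-1 *: z.
    rewrite /z !scalerA mulVf ?pnatr_eq0 // !scale1r addrC subrK //.
  have [eps eps0 He] := HB 1 ltr01.
  apply: Bconv => //.
    have [hz zz] : estep (tau * q) sigma 1 K z /\ (enorm (tau * q) sigma 1 K^° z <= 0%:E)%E.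
      apply: (estep_null s1) => // x Kx; rewrite /z.
      have -> : (2 *: (infop U a u - infop K^° a u)) x =
        2 * (infop U a u x - infop K^° a u x) by [].
      have Ux : U x by apply: KU; exact: interior_subset Kx.
      by rewrite /infop (mem_set Ux) (mem_set Kx) subrr mulr0.
    by apply: He => //; apply: le_lt_trans zz _; rewrite lte_fin.
  by rewrite ger0_norm ?invr_ge0 // -mulr2n -[_ *+ 2]mulr_natl divff ?pnatr_eq0.
exists W'; split=> //.
  move=> f g l m [[h h0 hf] Bf] [[h' h'0 hg] Bg] lm.
  pose h2 := Num.max h h'.
  have h20 : 0 < h2 by rewrite lt_max h0.
  have hf2 : estep tau sigma h2 K f.
    by apply: estep_homo hf => //; rewrite le_max lexx.
  have hg2 : estep tau sigma h2 K g.
    by apply: estep_homo hg => //; rewrite le_max lexx orbT.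
  have hc : estep tau sigma h2 K (l *: f + m *: g).
    rewrite comb_lin; exact: (estep_lin l hf2 (estep_lin (m - 1) hg2 hg2)).
  split; first by exists h2.
  have -> : infop K^° a (l *: f + m *: g) =
      l *: infop K^° a f + m *: infop K^° a g.
    apply/funext => x; have [Kx|Kx] := pselect (K^° x).
      rewrite (infop_comb _ _ (smooth_upto_smooth hf2.1) (smooth_upto_smooth hg2.1)) //.
        exact: (infop_cvg_estep ab h20 hf2).
      exact: (infop_cvg_estep ab h20 hg2).
    rewrite /infop memNset //.
    have -> : (l *: infop K^° a f + m *: infop K^° a g) x =
      l * infop K^° a f x + m * infop K^° a g x by [].
    by rewrite /infop memNset // !mulr0 addr0.
  have -> : 2 *: (l *: infop K^° a f + m *: infop K^° a g) =
      l *: (2 *: infop K^° a f) + m *: (2 *: infop K^° a g).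
    by rewrite scalerDr !scalerA ![2 * _]mulrC.
  exact: Bconv.
move=> h h0.
have [H [A [H0 A0 aA]]] := coef_dom_Roumieu s1 t0 p0 q0 pq tp ab h0.
have [eps eps0 He] := HB H H0.
(* P multiplies norms by 4 A at most; the factor 2 in W' and strictness take
   the rest of the 16. *)
exists (eps / (16 * A)); first by rewrite divr_gt0 // mulr_gt0.
move=> u hu uM; split; first by exists h.
have su := smooth_upto_smooth hu.1.
have uM' := enorm_lt_jet_le s1 h0 oK su (@subset_refl _ _) uM.
have M0 : 0 <= eps / (16 * A) by rewrite divr_ge0 ?mulr_ge0 // ltW.
have [hP PM] := estep_infop H0 (ltW A0) M0 Kcl hu.1 aA uM'.
have -> : 2 *: infop K^° a u = 1 *: infop K^° a u + infop K^° a u.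
  by rewrite scale1r -mulr2n scaler_nat.
apply: He; first exact: estep_lin.
have sP := smooth_upto_smooth hP.1.
apply: (@le_lt_trans _ _ ((cmod 1 * (4 * (eps / (16 * A)) * A) +
    4 * (eps / (16 * A)) * A)%:E)).
  exact: (enorm_lin_le s1 1 H0 sP sP PM PM).
rewrite lte_fin; have -> : cmod 1 = 1 :> R by rewrite /cmod normr1.
have -> : 4 * (eps / (16 * A)) * A = eps / 4.
  by field; rewrite gt_eqF.
lra.
Qed.

End continuity.

(*BEGIN*)
Section map.
Context {R : realType} {d : nat} (tau0 tau sigma p q : R) (c : uclass).
Context (a : mindex d -> R[i]) (U : set 'rV[R]_d).
Hypotheses (openU : open U) (s1 : 1 < sigma) (t0 : 0 < tau).
Hypotheses (p0 : 0 < p) (q0 : 0 < q) (pq : pow_split sigma p q).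
Hypotheses (tp : tau * p <= tau0 * 2 `^ (sigma - 1)).
Hypothesis a_bound : coef_bound c tau0 sigma a.
Local Notation E := (espace c tau sigma U).
Local Notation E' := (espace c (tau * q) sigma U).

Let maps := infop_maps_eclass openU s1 t0 p0 q0 pq tp a_bound.

Lemma espaceP tau' (f : espace c tau' sigma U) : eclass c tau' sigma U f.
Proof. by case: f => f /=; rewrite unfold_in in_setE. Qed.

Lemma infop_mem (f : E) : infop U a f \in eclass_pred c (tau * q) sigma U.
Proof. by rewrite unfold_in in_setE; have [_] := maps (espaceP f). Qed.

Definition infop_map (f : E) : E' := ESpace (infop_mem f).

Lemma infop_cvg_eclass f x : eclass c tau sigma U f -> U x -> infop_cvg a f x.
Proof.
move=> Ef Ux.
have [h [H [A [M [A0 M0 aA /nbhs_singleton fM]]]]] :=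
  eclass_loc openU s1 t0 p0 q0 pq tp a_bound Ef Ux.
exact: infop_cvg_dom A0 M0 aA fM.
Qed.

Lemma infop_map_linear : linear infop_map.
Proof.
move=> l f g; apply: val_inj => /=.
have [sf _ _] := espaceP f; have [sg _ _] := espaceP g.
apply/funext => x.
have -> : (l *: infop U a f + infop U a g) x =
  l * infop U a f x + 1 * infop U a g x by rewrite mul1r.
have [Ux|Ux] := pselect (U x); last by rewrite /infop memNset // !mulr0 addr0.
rewrite -(infop_comb l 1 sf sg Ux) ?scale1r //.
  exact: infop_cvg_eclass (espaceP f) Ux.
exact: infop_cvg_eclass (espaceP g) Ux.
Qed.

HB.instance Definition _ :=
  GRing.isLinear.Build R[i] E E' *:%R infop_map infop_map_linear.

Lemma nbhs0_local_infop K W : compact K -> K `<=` U -> smooth_boundary K ->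
  nbhs0_local c (tau * q) sigma K W ->
  exists2 W', nbhs0_local c tau sigma K W' &
    forall u, eclass c tau sigma U u -> W' u -> W (infop U a u).
Proof.
move=> cK KU bK; case: c a_bound => ab KW.
  exists [set u | eclass Beurling tau sigma U u -> W (infop U a u)].
    exact: (nbhs0_local_infop_Beurling openU s1 t0 p0 q0 pq tp ab KU cK KW).
  by move=> u Eu; apply.
have [W' HW' W'W] := nbhs0_local_infop_Roumieu s1 t0 p0 q0 pq tp ab KU
  (smooth_boundary_closure bK) KW.
by exists W' => // u _ /W'W.
Qed.

Lemma open_espaceE tau' (O : set (espace c tau' sigma U)) :
  open O = (forall f, O f -> nbhs_espace f O).
Proof. by []. Qed.

(** The sets whose preimage is a neighbourhood of f form a filter, so it suffices
    to treat the generating neighbourhoods of P f, one compact set at a time. *)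
Lemma infop_map_continuous : continuous infop_map.
Proof.
apply/continuousP => O; rewrite !open_espaceE => oO f Of.
have := oO (infop_map f) Of.
pose X := [set W : set E' | nbhs_espace f (infop_map @^-1` W)].
have FF := nbhs_espace_filter f.
suff : nbhs_espace (infop_map f) `<=` X by apply.
apply: smallest_sub.
  split; first exact: (@filterT _ _ FF).
    by move=> P Q; exact: (@filterI _ _ FF).
  by move=> P Q PQ; apply: (@filterS _ _ FF) => g /PQ.
move=> _ [K [W [cK KU bK KW ->]]].
have [W' KW' W'W] := nbhs0_local_infop cK KU bK KW.
rewrite /X /=.
have gen : nbhs_espace f [set g : E | W' ((g : 'rV[R]_d -> R[i]) - f)].
  by apply: (sub_smallest (@subset_refl _ _)); exists K, W'.
apply: (@filterS _ _ FF) gen => g /= W'gf.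
have := W'W _ (espaceP (g - f)) W'gf.
have /(congr1 val) /= : infop_map (g - f) = infop_map g - infop_map f by exact: raddfB.
by move=> ->.
Qed.

End map.

Unset Implicit Arguments.
Set Strict Implicit.

Theorem theorem2p2 (R : realType) (d : nat) (U : set 'rV[R]_d)
    (tau sigma : R) (c : uclass) (a : mindex d -> R[i])
    (openU : open U) (tau_gt0 : 0 < tau) (sigma_gt1 : 1 < sigma)
    (a_bound : coef_bound c tau sigma a) :
  [/\ (forall tau', 0 < tau' -> tau' < tau * 2 `^ (sigma - 1) ->
        infop_maps U a (eclass c tau' sigma U) (eclass_infty c sigma U)),
      ((forall tau', 0 < tau' -> coef_bound c tau' sigma a) ->
        infop_maps U a (eclass_infty c sigma U) (eclass_infty c sigma U)) &
      exists T : {linear espace c tau sigma U ->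
                         espace c (tau * 2 `^ (sigma - 1)) sigma U},
        continuous T /\
        forall f : espace c tau sigma U,
          infop_converges U a f /\ T f = infop U a f :> ('rV[R]_d -> R[i])].
Proof.
have q0 : 0 < 2 `^ (sigma - 1) :> R by rewrite powR_gt0.
have convex := pow_split_convex (ltW sigma_gt1).
split.
- move=> tau' tau'0 tau'_lt f Ef.
  have p1 : 1 < tau * 2 `^ (sigma - 1) / tau' by rewrite ltr_pdivlMr ?mul1r.
  have [q qgt0 split_pq] := pow_split_above (ltW sigma_gt1) p1.
  have le_p : tau' * (tau * 2 `^ (sigma - 1) / tau') <= tau * 2 `^ (sigma - 1).
    by rewrite mulrC divfK // gt_eqF.
  have [cPf Pf] := infop_maps_eclass openU sigma_gt1 tau'0 (lt_trans ltr01 p1)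
    qgt0 split_pq le_p a_bound Ef.
  by split=> //; exists (tau' * q) => //; rewrite mulr_gt0.
- move=> ab f [tau' tau'0 Ef].
  have [cPf Pf] := infop_maps_eclass openU sigma_gt1 tau'0 q0 q0 convex
    (lexx _) (ab tau' tau'0) Ef.
  by split=> //; exists (tau' * 2 `^ (sigma - 1)) => //; rewrite mulr_gt0.
- exists (infop_map openU sigma_gt1 tau_gt0 q0 q0 convex (lexx _) a_bound); split.
    exact: infop_map_continuous.
  move=> f; split=> //.
  by have [] := infop_maps_eclass openU sigma_gt1 tau_gt0 q0 q0 convex
    (lexx _) a_bound (espaceP f).
Qed.
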